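(* Let $p\in(1,2]$ and let $\mathcal Z$ be a $p$-uniformly smooth Banach space. If a metric space $(X,d)$ threshold-embeds into $\mathcal Z$, then $X$ has Markov type $p$. Quantitatively, there is a universal constant $C>0$ such that if $X$ $D$-threshold-embeds into $\mathcal Z$, then $M_p(X)\le C\, D\, S_p(\mathcal Z)$.
   Context: Threshold embedding: a metric space $(X,d_X)$ $K$-threshold-embeds into a metric space $(Y,d_Y)$ if there is a family of Lipschitz maps $\{\varphi_\tau:X\to Y\}_{\tau>0}$ such that for every $\tau>0$ and all $x,y\in X$, $d_X(x,y)\ge\tau$ implies $d_Y(\varphi_\tau(x),\varphi_\tau(y))\ge \|\varphi_\tau\|_{\mathrm{Lip}}\,\tau/K$, where $\|\cdot\|_{\mathrm{Lip}}$ is the Lipschitz constant. $X$ threshold-embeds into $Y$ if it $K$-threshold-embeds for some $K>0$. Markov type: $(X,d)$ has Markov type $p\in[1,\infty)$ if there is $M>0$ such that for every $n\in\mathbb N$, every stationary reversible Markov chain $\{Z_t\}_{t\ge0}$ on $\{1,\dots,n\}$ (with $Z_0$ distributed according to the stationary measure), every map $f:\{1,\dots,n\}\to X$ and every $t\in\mathbb N$, $\mathbb E\, d(f(Z_t),f(Z_0))^p\le M^p t\,\mathbb E\, d(f(Z_0),f(Z_1))^p$. $M_p(X)$ denotes the infimal such $M$. Uniform smoothness: for a Banach space $\mathcal Z$, $\rho_{\mathcal Z}(\varepsilon)=\sup\{\frac{\|x+\varepsilon y\|+\|x-\varepsilon y\|}{2}-1:\|x\|=\|y\|=1\}$. $\mathcal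 Z$ is $p$-uniformly smooth if there is $S>0$ with $\rho_{\mathcal Z}(\varepsilon)\le S^p\varepsilon^p$ for all $\varepsilon>0$; $S_p(\mathcal Z)$ is the infimal such $S$.
   Formalization: Threshold embedding is read with a number L>0 bounding the Lipschitz constant of φ_τ and separation at least Lτ/K; this excludes constant maps at scales where some pair has distance at least τ, which would otherwise make every metric space threshold-embed and the claim false. *)

(* Defs.v *)
From Stdlib Require Import Reals Lra.
Open Scope R_scope.

(* Real power x^a for x >= 0 (with 0^a = 0 for a > 0); junk 0 for x <= 0. *)
Definition rpow (x a : R) : R :=
  if Rlt_dec 0 x then Rpower x a else 0.

Fixpoint fsum (n : nat) (g : nat -> R) : R :=
  match n with
  | O => 0
  | S m => fsum m g + g m
  end.

Definition is_metric {X : Type} (d : X -> X -> R) : Prop :=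
  (forall x y, 0 <= d x y) /\
  (forall x y, d x y = 0 <-> x = y) /\
  (forall x y, d x y = d y x) /\
  (forall x y z, d x z <= d x y + d y z).

Record Banach : Type := {
  bcar :> Type;
  bzero : bcar;
  badd : bcar -> bcar -> bcar;
  bopp : bcar -> bcar;
  bscal : R -> bcar -> bcar;
  bnorm : bcar -> R;
  badd_assoc : forall x y z, badd x (badd y z) = badd (badd x y) z;
  badd_comm : forall x y, badd x y = badd y x;
  badd_0 : forall x, badd bzero x = x;
  badd_opp : forall x, badd (bopp x) x = bzero;
  bscal_assoc : forall a b x, bscal a (bscal b x) = bscal (a * b) x;
  bscal_1 : forall x, bscal 1 x = x;
  bscal_distr_v : forall a x y, bscal a (badd x y) = badd (bscal a x) (bscal a y);
  bscal_distr_s : forall a b x, bscal (a + b) x = badd (bscal a x) (bscal b x);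
  bnorm_eq0 : forall x, bnorm x = 0 -> x = bzero;
  bnorm_scal : forall a x, bnorm (bscal a x) = Rabs a * bnorm x;
  bnorm_triangle : forall x y, bnorm (badd x y) <= bnorm x + bnorm y;
  bcomplete : forall u : nat -> bcar,
    (forall eps, 0 < eps -> exists N, forall m n, (N <= m)%nat -> (N <= n)%nat ->
        bnorm (badd (u m) (bopp (u n))) < eps) ->
    exists l, forall eps, 0 < eps -> exists N, forall n, (N <= n)%nat ->
        bnorm (badd (u n) (bopp l)) < eps
}.

Definition bsub (Z : Banach) (x y : Z) : Z := badd Z x (bopp Z y).

(* rho_Z(eps) <= S^p eps^p for all eps > 0, written out through the sup:
   every quantity in the sup defining rho_Z(eps) is <= S^p eps^p. *)
Definition smooth_with (Z : Banach) (p S : R) : Prop :=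
  forall (eps : R) (x y : Z), 0 < eps -> bnorm Z x = 1 -> bnorm Z y = 1 ->
    (bnorm Z (badd Z x (bscal Z eps y)) + bnorm Z (bsub Z x (bscal Z eps y))) / 2 - 1
      <= rpow S p * rpow eps p.

Definition threshold_embeds (X : Type) (d : X -> X -> R) (Z : Banach) (K : R) : Prop :=
  0 < K /\
  forall tau, 0 < tau ->
    exists (phi : X -> Z) (L : R), 0 < L /\
      (forall x y, bnorm Z (bsub Z (phi x) (phi y)) <= L * d x y) /\
      (forall x y, tau <= d x y -> L * tau / K <= bnorm Z (bsub Z (phi x) (phi y))).

Fixpoint mpow (n : nat) (P : nat -> nat -> R) (t : nat) (i j : nat) : R :=
  match t with
  | O => if Nat.eqb i j then 1 else 0
  | S t' => fsum n (fun k => mpow n P t' i k * P k j)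
  end.

Definition reversible_chain (n : nat) (pi : nat -> R) (P : nat -> nat -> R) : Prop :=
  (forall i, (i < n)%nat -> 0 <= pi i) /\
  fsum n pi = 1 /\
  (forall i j, (i < n)%nat -> (j < n)%nat -> 0 <= P i j) /\
  (forall i, (i < n)%nat -> fsum n (fun j => P i j) = 1) /\
  (forall j, (j < n)%nat -> fsum n (fun i => pi i * P i j) = pi j) /\
  (forall i j, (i < n)%nat -> (j < n)%nat -> pi i * P i j = pi j * P j i).

(* E d(f(Z_t), f(Z_0))^p  for Z_0 ~ pi. *)
Definition markov_moment {X : Type} (d : X -> X -> R) (p : R)
    (n : nat) (pi : nat -> R) (P : nat -> nat -> R) (f : nat -> X) (t : nat) : R :=
  fsum n (fun i => fsum n (fun j => pi i * mpow n P t i j * rpow (d (f i) (f j)) p)).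

(* X has Markov type p with constant M (so M_p(X) <= M). *)
Definition markov_type_const (X : Type) (d : X -> X -> R) (p M : R) : Prop :=
  forall (n : nat) (pi : nat -> R) (P : nat -> nat -> R) (f : nat -> X) (t : nat),
    reversible_chain n pi P ->
    markov_moment d p n pi P f t <= rpow M p * INR t * markov_moment d p n pi P f 1.

(* Main.v *)
(** The threshold maps [phi_tau] are used one scale at a time: with [u = tau^p], the
    layer-cake formula writes [E d(Z_0,Z_t)^p] as an integral over [u] of
    [P(|phi_tau(Z_t) - phi_tau(Z_0)| >= L tau / D)].  By reversibility this displacement
    is, up to a small boundary term, half a forward martingale minus half a martingale
    of the reversed chain.  Markov's inequality for the [p]-th moment would lose a
    logarithm after integration in [u]; instead, a supermartingale built from
    [v = |M|^p] and the predictable variation [A] (both in units of [u]) gives the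
    second-moment tail bound
    [P(v >= 1) <= 28 E min(1, A^2) + 4 E sum_s e(Z_s)], where [e] collects the jumps
    [min(1, |Delta M|^(2p))]; since the integral of [min(1, (x/u)^2)] over [u > 0] is
    proportional to [x], the integrated bound is linear in the moments [E d(Z_0,Z_1)^p].
    Dyadic values of [u] replace the integral. *)
Require Import Defs.
From Stdlib Require Import Reals Lra Psatz Lia List Classical.
Import ListNotations.
Open Scope R_scope.

(** * Real powers *)

(** The constant must not degenerate as [p] tends to 1. The real-variable estimates therefore pass
    through the exponent [p / 2], where concavity and subadditivity have constants uniform in [p].
    Threshold maps at different scales are unrelated, so no single image of the chain can be
    followed. What survives a change of scale is a domination: after rescaling, the [p]-th powers of
    the image increments are at most [q i j / u], with [q] independent of [u]. The tail bound is
    phrased through functionals of these dominating quantities alone, and the sum over scales is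
    taken path by path, inside the expectation. Thus only the mean of the accumulated functional is
    ever needed, never its second moment, and stationarity makes this mean [INR t] times a one-step
    mean. Jumps must enter truncated for the same reason: the bound involves [2p]-th powers of
    increments, while only their [p]-th moments are at hand. *)

Lemma rpow_of_pos x a : 0 < x -> rpow x a = Rpower x a.
Proof. intros; unfold rpow; destruct (Rlt_dec 0 x); lra. Qed.

Lemma rpow_0_l a : rpow 0 a = 0.
Proof. unfold rpow; destruct (Rlt_dec 0 0); lra. Qed.

Lemma Rpower_pos x a : 0 < Rpower x a.
Proof. apply exp_pos. Qed.

Lemma rpow_nonneg x a : 0 <= rpow x a.
Proof.
  unfold rpow; destruct (Rlt_dec 0 x); [left; apply Rpower_pos | lra].
Qed.

Lemma rpow_pos x a : 0 < x -> 0 < rpow x a.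
Proof. intros; rewrite rpow_of_pos by assumption; apply Rpower_pos. Qed.

Lemma rpow_1_l a : rpow 1 a = 1.
Proof.
  rewrite rpow_of_pos by lra. unfold Rpower. rewrite ln_1, Rmult_0_r. apply exp_0.
Qed.

Lemma rpow_1_r x : 0 <= x -> rpow x 1 = x.
Proof.
  intros [h | <-]; [| apply rpow_0_l].
  rewrite rpow_of_pos by assumption; now apply Rpower_1.
Qed.

Lemma rpow_le x y a : 0 <= a -> x <= y -> rpow x a <= rpow y a.
Proof.
  intros ha hxy. unfold rpow at 1. destruct (Rlt_dec 0 x) as [h|h].
  - rewrite rpow_of_pos by lra. apply Rle_Rpower_l; lra.
  - apply rpow_nonneg.
Qed.

Lemma rpow_lt x y a : 0 < a -> 0 <= x -> x < y -> rpow x a < rpow y a.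
Proof.
  intros ha [hx | <-] hxy.
  - rewrite !rpow_of_pos by lra. apply Rlt_Rpower_l; lra.
  - rewrite rpow_0_l. now apply rpow_pos.
Qed.

Lemma rpow_le_inv x y a : 0 < a -> 0 <= y -> rpow x a <= rpow y a -> x <= y.
Proof.
  intros ha hy h. destruct (Rle_lt_dec x y) as [|hlt]; trivial.
  pose proof (rpow_lt y x a ha hy hlt); lra.
Qed.

Lemma rpow_mult x y a : 0 <= x -> 0 <= y -> rpow (x * y) a = rpow x a * rpow y a.
Proof.
  intros [hx | <-] [hy | <-]; rewrite ?Rmult_0_l, ?Rmult_0_r, ?rpow_0_l; try ring.
  rewrite !rpow_of_pos by (try assumption; now apply Rmult_lt_0_compat).
  symmetry; now apply Rpower_mult_distr.
Qed.

Lemma rpow_rpow x a b : rpow (rpow x a) b = rpow x (a * b).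
Proof.
  unfold rpow at 2 3. destruct (Rlt_dec 0 x); [| apply rpow_0_l].
  rewrite rpow_of_pos by apply Rpower_pos. apply Rpower_mult.
Qed.

Lemma rpow_add x a b : rpow x (a + b) = rpow x a * rpow x b.
Proof.
  unfold rpow; destruct (Rlt_dec 0 x); [apply Rpower_plus | ring].
Qed.

(** Writing a [p]-th power as a square lets [p <= 2] act as [p / 2 <= 1], where the power is concave
    and subadditive. *)
Lemma rpow_half_sqr x a : rpow x a = rpow x (a / 2) * rpow x (a / 2).
Proof. rewrite <- rpow_add. f_equal; lra. Qed.

Lemma rpow_of_sqr x a : 0 <= x -> rpow (x * x) (a / 2) = rpow x a.
Proof. intros; rewrite rpow_mult by assumption; symmetry; apply rpow_half_sqr. Qed.

Lemma rpow_inv x a : 0 < x -> rpow (/ x) a = / rpow x a.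
Proof.
  intros hx. assert (h := rpow_pos x a hx). assert (0 < / x) by now apply Rinv_0_lt_compat.
  apply Rmult_eq_reg_r with (rpow x a); [| lra].
  rewrite <- rpow_mult by lra. rewrite !Rinv_l by lra. apply rpow_1_l.
Qed.

Lemma rpow_2_r x : 0 <= x -> rpow x 2 = x * x.
Proof.
  intros; replace 2 with (1 + 1) by ring. now rewrite rpow_add, !rpow_1_r.
Qed.

Lemma rpow_exp_le x a b : 1 <= x -> a <= b -> rpow x a <= rpow x b.
Proof.
  intros. rewrite !rpow_of_pos by lra. destruct (Req_dec x 1) as [->|].
  - unfold Rpower; rewrite ln_1, !Rmult_0_r; lra.
  - now apply Rle_Rpower; lra.
Qed.

Lemma rpow_exp_ge x a b : 0 <= x <= 1 -> a <= b -> rpow x b <= rpow x a.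
Proof.
  intros [[hx | <-] hx1] hab; [| rewrite !rpow_0_l; lra].
  assert (hix : 1 <= / x) by (rewrite <- Rinv_1; apply Rinv_le_contravar; lra).
  assert (h := rpow_exp_le _ _ _ hix hab). rewrite !rpow_inv in h by assumption.
  apply Rinv_le_contravar in h; [| apply Rinv_0_lt_compat, rpow_pos, hx].
  now rewrite !Rinv_inv in h.
Qed.

Lemma ln_le_sub1 x : 0 < x -> ln x <= x - 1.
Proof.
  intros hx. pose proof (exp_ineq1_le (ln x)) as h. rewrite exp_ln in h; lra.
Qed.

(* Weighted AM-GM between [y] and [1]: add [ln z <= z - 1] at [z = y / m] and [z = 1 / m]. *)
Lemma rpow_le_tangent y a : 0 <= y -> 0 < a <= 1 -> rpow y a <= 1 + a * (y - 1).
Proof.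
  intros [hy | <-] ha; [| rewrite rpow_0_l; lra].
  set (m := 1 + a * (y - 1)).
  assert (hm : 0 < m) by (unfold m; nra).
  rewrite rpow_of_pos by assumption. unfold Rpower.
  rewrite <- (exp_ln m) by assumption.
  assert (h1 := ln_le_sub1 (y * / m)). assert (h2 := ln_le_sub1 (/ m)).
  assert (hi : 0 < / m) by now apply Rinv_0_lt_compat.
  rewrite ln_mult in h1 by assumption. rewrite ln_Rinv in h1, h2 by assumption.
  specialize (h2 hi). specialize (h1 (Rmult_lt_0_compat _ _ hy hi)).
  assert (hz : a * (y * / m - 1) + (1 - a) * (/ m - 1) = 0) by (unfold m; field; fold m; lra).
  assert (hle : a * ln y <= ln m) by nra.
  destruct hle as [hlt | ->]; [left; now apply exp_increasing | lra].
Qed.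

(** Apply the concave case to [y^a] with exponent [/ a] and solve for [y^a]. *)
Lemma rpow_ge_tangent y a : 0 <= y -> 1 <= a -> 1 + a * (y - 1) <= rpow y a.
Proof.
  intros hy ha.
  assert (hi : 0 < / a <= 1).
  { split; [apply Rinv_0_lt_compat; lra |]. rewrite <- Rinv_1. apply Rinv_le_contravar; lra. }
  assert (h := rpow_le_tangent (rpow y a) (/ a) (rpow_nonneg _ _) hi).
  rewrite rpow_rpow, Rinv_r, rpow_1_r in h by lra.
  apply Rmult_le_compat_l with (r := a) in h; [| lra].
  rewrite Rmult_plus_distr_l, <- Rmult_assoc, Rinv_r in h by lra. lra.
Qed.

Lemma rpow_mid_concave x y a : 0 <= x -> 0 <= y -> 0 < a <= 1 ->
  (rpow x a + rpow y a) / 2 <= rpow ((x + y) / 2) a.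
Proof.
  intros hx hy ha. set (m := (x + y) / 2).
  destruct (Req_dec m 0) as [h0|h0].
  - assert (x = 0) by (unfold m in h0; lra). assert (y = 0) by (unfold m in h0; lra).
    subst x y. rewrite h0, !rpow_0_l; lra.
  - assert (hm : 0 < m) by (unfold m in *; lra).
    assert (hi : 0 < / m) by now apply Rinv_0_lt_compat.
    assert (h1 := rpow_le_tangent (x * / m) a ltac:(nra) ha).
    assert (h2 := rpow_le_tangent (y * / m) a ltac:(nra) ha).
    assert (hs : x * / m + y * / m = 2) by (unfold m; field; unfold m in h0; lra).
    clearbody m.
    assert (ex : rpow x a = rpow m a * rpow (x * / m) a).
    { rewrite <- rpow_mult by nra. f_equal. field. lra. }
    assert (ey : rpow y a = rpow m a * rpow (y * / m) a).
    { rewrite <- rpow_mult by nra. f_equal. field. lra. }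
    rewrite ex, ey. assert (hp := rpow_pos m a hm).
    assert (h3 : rpow (x * / m) a + rpow (y * / m) a <= 2).
    { replace (y * / m) with (2 - x * / m) in * by lra. lra. }
    nra.
Qed.

(** Once the sum is normalised to 1, both fractions lie in [0,1], where [z <= z^a]. *)
Lemma rpow_subadd x y a : 0 <= x -> 0 <= y -> 0 < a <= 1 ->
  rpow (x + y) a <= rpow x a + rpow y a.
Proof.
  intros hx hy ha. destruct (Req_dec (x + y) 0) as [h0|h0].
  - rewrite h0, rpow_0_l. pose proof (rpow_nonneg x a). pose proof (rpow_nonneg y a). lra.
  - set (m := x + y) in *. assert (hm : 0 < m) by (unfold m in *; lra).
    assert (hi : 0 < / m) by now apply Rinv_0_lt_compat.
    assert (hs : x * / m + y * / m = 1) by (unfold m; field; assumption).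
    assert (hx0 : 0 <= x * / m) by nra. assert (hy0 : 0 <= y * / m) by nra.
    assert (h1 := rpow_exp_ge (x * / m) a 1 ltac:(lra) ltac:(lra)).
    assert (h2 := rpow_exp_ge (y * / m) a 1 ltac:(lra) ltac:(lra)).
    rewrite rpow_1_r in h1, h2 by assumption.
    clearbody m.
    assert (ex : rpow x a = rpow m a * rpow (x * / m) a).
    { rewrite <- rpow_mult by lra. f_equal. field. lra. }
    assert (ey : rpow y a = rpow m a * rpow (y * / m) a).
    { rewrite <- rpow_mult by lra. f_equal. field. lra. }
    rewrite ex, ey. assert (hp := rpow_pos m a hm).
    assert (h3 : 1 <= rpow (x * / m) a + rpow (y * / m) a) by lra.
    nra.
Qed.

Lemma rpow_add_le x y p : 0 <= x -> 0 <= y -> 1 < p <= 2 ->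
  rpow (x + y) p <= 2 * (rpow x p + rpow y p).
Proof.
  intros hx hy hp. rewrite !(rpow_half_sqr _ p).
  assert (h := rpow_subadd x y (p / 2) hx hy ltac:(lra)).
  assert (h0 := rpow_nonneg (x + y) (p / 2)).
  assert (h1 := rpow_nonneg x (p / 2)). assert (h2 := rpow_nonneg y (p / 2)).
  set (s := rpow (x + y) (p / 2)) in *. set (u := rpow x (p / 2)) in *.
  set (v := rpow y (p / 2)) in *.
  apply Rle_trans with ((u + v) * (u + v)); [apply Rmult_le_compat; lra |].
  pose proof (Rle_0_sqr (u - v)) as hsq; unfold Rsqr in hsq. lra.
Qed.

(* Concavity of [t^(p/2)] applied to the squares [(A+e)^2], [(A-e)^2]. *)
Lemma rpow_two_point A e p : 0 <= e <= A -> 1 < p <= 2 ->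
  (rpow (A + e) p + rpow (A - e) p) / 2 <= rpow A p + rpow e p.
Proof.
  intros he hp.
  rewrite <- (rpow_of_sqr (A + e)), <- (rpow_of_sqr (A - e)), <- (rpow_of_sqr A),
    <- (rpow_of_sqr e) by lra.
  eapply Rle_trans; [apply rpow_mid_concave; nra |].
  replace (((A + e) * (A + e) + (A - e) * (A - e)) / 2) with (A * A + e * e) by field.
  apply rpow_subadd; nra.
Qed.

(* With [s = a^(p/2)], [t = b^(p/2)], subadditivity of [x^(p/2)] gives [|t - s| <= h^(p/2)]. *)
Lemma rpow_increment_sqr a b h p : 0 <= a -> 0 <= b -> 0 <= h -> 1 < p <= 2 ->
  a <= b + h -> b <= a + h ->
  (rpow b p - rpow a p) ^ 2 <= rpow h p * (8 * rpow a p + 2 * rpow h p).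
Proof.
  intros ha hb hh hp hab hba. rewrite !(rpow_half_sqr _ p).
  assert (h1 : rpow b (p / 2) <= rpow a (p / 2) + rpow h (p / 2)).
  { eapply Rle_trans; [| apply rpow_subadd; lra]. apply rpow_le; lra. }
  assert (h2 : rpow a (p / 2) <= rpow b (p / 2) + rpow h (p / 2)).
  { eapply Rle_trans; [| apply rpow_subadd; lra]. apply rpow_le; lra. }
  assert (h3 := rpow_nonneg a (p / 2)). assert (h4 := rpow_nonneg b (p / 2)).
  assert (h5 := rpow_nonneg h (p / 2)).
  set (s := rpow a (p / 2)) in *. set (t := rpow b (p / 2)) in *. set (k := rpow h (p / 2)) in *.
  replace ((t * t - s * s) ^ 2) with ((t - s) ^ 2 * (t + s) ^ 2) by ring.
  assert (h6 : (t - s) ^ 2 <= k * k) by nra.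
  assert (h7 : (t + s) ^ 2 <= 8 * (s * s) + 2 * (k * k)).
  { apply Rle_trans with ((2 * s + k) ^ 2); [apply pow_incr; lra |].
    pose proof (pow2_ge_0 (2 * s - k)). lra. }
  apply Rmult_le_compat; trivial; apply pow2_ge_0.
Qed.

(** * Truncated squares *)

Definition trunc_sqr (z : R) : R := Rmin 1 (z * z).

Lemma trunc_sqr_le1 z : trunc_sqr z <= 1.
Proof. apply Rmin_l. Qed.

Lemma trunc_sqr_le_sqr z : trunc_sqr z <= z * z.
Proof. apply Rmin_r. Qed.

Lemma trunc_sqr_small z : 0 <= z <= 1 -> trunc_sqr z = z * z.
Proof. intros; apply Rmin_right; nra. Qed.

Lemma trunc_sqr_large z : 1 <= z -> trunc_sqr z = 1.
Proof. intros; apply Rmin_left; nra. Qed.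

Lemma trunc_sqr_nonneg z : 0 <= trunc_sqr z.
Proof. apply Rmin_glb; nra. Qed.

Lemma trunc_sqr_mono x y : 0 <= x <= y -> trunc_sqr x <= trunc_sqr y.
Proof.
  intros. apply Rmin_glb; [apply trunc_sqr_le1 |].
  eapply Rle_trans; [apply trunc_sqr_le_sqr | nra].
Qed.

(** Expansion of [w^2] around [v], kept linear in [w] so that its average involves only the mean of
    [w]. For [h <= 1] the remainder [2 * h^2] is the truncated term; for [h > 1] the truncated term
    equals 2 and dominates trivially. *)
Lemma trunc_sqr_step v w h : 0 <= v < 1 -> 0 <= w -> 0 <= h ->
  (w - v) ^ 2 <= h * (8 * v + 2 * h) ->
  trunc_sqr w <= v * v + 2 * v * (w - v) + 8 * v * h + 2 * trunc_sqr h.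
Proof.
  intros hv hw hh hs. destruct (Rle_lt_dec h 1) as [h1|h1].
  - rewrite (trunc_sqr_small h) by lra. pose proof (trunc_sqr_le_sqr w). nra.
  - rewrite (trunc_sqr_large h) by lra. pose proof (trunc_sqr_le1 w).
    assert (0 <= v * w) by nra. assert (0 <= v * h) by nra. nra.
Qed.

(** * Finite sums and Jensen's inequality *)

Lemma fsum_ext n g h : (forall i, (i < n)%nat -> g i = h i) -> fsum n g = fsum n h.
Proof.
  induction n as [|n IH]; intros H; simpl; trivial.
  rewrite (IH (fun i hi => H i (Nat.lt_lt_succ_r _ _ hi))), (H n); auto.
Qed.

Lemma fsum_le n g h : (forall i, (i < n)%nat -> g i <= h i) -> fsum n g <= fsum n h.
Proof.
  induction n as [|n IH]; intros H; simpl; [lra |].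
  apply Rplus_le_compat; auto.
Qed.

Lemma fsum_plus n g h : fsum n (fun i => g i + h i) = fsum n g + fsum n h.
Proof. induction n as [|n IH]; simpl; rewrite ?IH; ring. Qed.

Lemma fsum_scal n c g : fsum n (fun i => c * g i) = c * fsum n g.
Proof. induction n as [|n IH]; simpl; rewrite ?IH; ring. Qed.

Lemma fsum_scal_r n c g : fsum n (fun i => g i * c) = fsum n g * c.
Proof. induction n as [|n IH]; simpl; rewrite ?IH; ring. Qed.

Lemma fsum_0 n : fsum n (fun _ => 0) = 0.
Proof. induction n as [|n IH]; simpl; rewrite ?IH; ring. Qed.

Lemma fsum_nonneg n g : (forall i, (i < n)%nat -> 0 <= g i) -> 0 <= fsum n g.
Proof. intros H; rewrite <- (fsum_0 n); now apply fsum_le. Qed.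

Lemma fsum_swap n m g :
  fsum n (fun i => fsum m (fun j => g i j)) = fsum m (fun j => fsum n (fun i => g i j)).
Proof.
  induction n as [|n IH]; simpl; [now rewrite fsum_0 | now rewrite IH, fsum_plus].
Qed.

Lemma fsum_term_le n g k :
  (forall i, (i < n)%nat -> 0 <= g i) -> (k < n)%nat -> g k <= fsum n g.
Proof.
  induction n as [|n IH]; intros H hk; [lia |]. simpl.
  assert (h0 : 0 <= fsum n g) by (apply fsum_nonneg; auto).
  destruct (Nat.eq_dec k n) as [-> | hne]; [lra |].
  assert (0 <= g n) by auto. assert (g k <= fsum n g) by (apply IH; auto; lia). lra.
Qed.

Lemma fsum_delta n i g :
  (i < n)%nat -> fsum n (fun k => (if Nat.eqb i k then 1 else 0) * g k) = g i.
Proof.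
  induction n as [|n IH]; intros hi; [lia |]. simpl.
  destruct (Nat.eqb_spec i n) as [-> | hne]; [| rewrite IH by lia; ring].
  rewrite (fsum_ext n _ (fun _ => 0)), fsum_0; [ring |].
  intros k hk. destruct (Nat.eqb_spec n k); [lia | ring].
Qed.

(* Sum the tangent-line inequality at the mean. *)
Lemma rpow_jensen n w t a : 1 <= a ->
  (forall i, (i < n)%nat -> 0 <= w i) -> fsum n w = 1 ->
  (forall i, (i < n)%nat -> 0 <= t i) ->
  rpow (fsum n (fun i => w i * t i)) a <= fsum n (fun i => w i * rpow (t i) a).
Proof.
  intros ha hw hw1 ht. set (m := fsum n (fun i => w i * t i)).
  assert (h0 : 0 <= m).
  { apply fsum_nonneg; intros; apply Rmult_le_pos; auto. }
  destruct h0 as [hm | <-].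
  - assert (hp := rpow_pos m a hm).
    assert (hi : 0 < / m) by now apply Rinv_0_lt_compat.
    assert (h : fsum n (fun i => w i * (rpow m a * (1 + a * (t i * / m - 1))))
                <= fsum n (fun i => w i * rpow (t i) a)).
    { apply fsum_le; intros i hi'. apply Rmult_le_compat_l; [auto |].
      specialize (ht i hi').
      replace (rpow (t i) a) with (rpow m a * rpow (t i * / m) a).
      - apply Rmult_le_compat_l; [lra |]. apply rpow_ge_tangent; [nra | lra].
      - rewrite <- rpow_mult by nra. f_equal. clearbody m. field; lra. }
    eapply Rle_trans; [| exact h]. right.
    rewrite (fsum_ext n _ (fun i => (rpow m a * (1 - a)) * w i
                               + (rpow m a * a * / m) * (w i * t i))) by (intros; ring).
    rewrite fsum_plus, !fsum_scal, hw1. fold m. clearbody m. field; lra.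
  - rewrite rpow_0_l. apply fsum_nonneg; intros. apply Rmult_le_pos; auto using rpow_nonneg.
Qed.

(** * Uniform smoothness and centered perturbations *)

Section Vectors.
Context {Z : Banach}.
Implicit Types x y z : Z.

Local Notation "x '+v' y" := (badd Z x y) (at level 50, left associativity).
Local Notation "'-v' x" := (bopp Z x) (at level 35, right associativity).
Local Notation "a '*v' x" := (bscal Z a x) (at level 40, left associativity).
Local Notation "'0v'" := (bzero Z).
Local Notation "'|v' x '|'" := (bnorm Z x) (at level 30, x at level 60).

Lemma badd_0_r x : x +v 0v = x.
Proof. rewrite badd_comm; apply badd_0. Qed.

Lemma badd_opp_r x : x +v -v x = 0v.
Proof. rewrite badd_comm; apply badd_opp. Qed.

Lemma badd_ACA x y z t : (x +v y) +v (z +v t) = (x +v z) +v (y +v t).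
Proof.
  rewrite <- !badd_assoc. f_equal. rewrite !badd_assoc. f_equal. apply badd_comm.
Qed.

Lemma badd_cancel_l x y z : x +v y = x +v z -> y = z.
Proof.
  intros h. rewrite <- (badd_0 Z y), <- (badd_0 Z z), <- (badd_opp Z x), <- !badd_assoc.
  now rewrite h.
Qed.

Lemma bscal_0_l x : 0 *v x = 0v.
Proof.
  apply (badd_cancel_l (0 *v x)). rewrite badd_0_r, <- bscal_distr_s. f_equal; ring.
Qed.

Lemma bopp_scal x : -v x = (-1) *v x.
Proof.
  apply (badd_cancel_l x). rewrite badd_opp_r. rewrite <- (bscal_1 Z x) at 1.
  rewrite <- bscal_distr_s. replace (1 + -1) with 0 by ring. now rewrite bscal_0_l.
Qed.

Lemma bscal_opp a x : a *v (-v x) = -v (a *v x).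
Proof. rewrite !bopp_scal, !bscal_assoc. f_equal; ring. Qed.

Lemma bopp_add x y : -v (x +v y) = -v x +v -v y.
Proof. rewrite !bopp_scal; apply bscal_distr_v. Qed.

Lemma bopp_opp x : -v -v x = x.
Proof. rewrite !bopp_scal, bscal_assoc. replace (-1 * -1) with 1 by ring. apply bscal_1. Qed.

Lemma bopp_0 : -v 0v = 0v.
Proof. apply (badd_cancel_l 0v). now rewrite badd_opp_r, badd_0. Qed.

Lemma bnorm_0 : |v 0v| = 0.
Proof. rewrite <- (bscal_0_l 0v), bnorm_scal, Rabs_R0; ring. Qed.

Lemma bnorm_opp x : |v -v x| = |v x|.
Proof. rewrite bopp_scal, bnorm_scal, Rabs_left; lra. Qed.

Lemma bnorm_nonneg x : 0 <= |v x|.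
Proof.
  assert (h := bnorm_triangle Z x (-v x)). rewrite badd_opp_r, bnorm_0, bnorm_opp in h. lra.
Qed.

Lemma bnorm_le_add x y : |v x| <= |v x +v y| + |v y|.
Proof.
  assert (h := bnorm_triangle Z (x +v y) (-v y)).
  rewrite <- badd_assoc, badd_opp_r, badd_0_r, bnorm_opp in h. exact h.
Qed.

Lemma bsub_add x y : x +v bsub Z y x = y.
Proof. unfold bsub. now rewrite badd_comm, <- badd_assoc, badd_opp, badd_0_r. Qed.

Fixpoint vsum (n : nat) (v : nat -> Z) : Z :=
  match n with
  | O => 0v
  | S m => vsum m v +v v m
  end.

Lemma vsum_add n v w : vsum n (fun i => v i +v w i) = vsum n v +v vsum n w.
Proof.
  induction n as [|n IH]; simpl; [now rewrite badd_0 | rewrite IH; apply badd_ACA].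
Qed.

Lemma vsum_scal_l n (w : nat -> R) x : vsum n (fun i => w i *v x) = fsum n w *v x.
Proof.
  induction n as [|n IH]; simpl; [now rewrite bscal_0_l |].
  now rewrite IH, bscal_distr_s.
Qed.

Lemma vsum_opp n v : vsum n (fun i => -v (v i)) = -v (vsum n v).
Proof.
  induction n as [|n IH]; simpl; [now rewrite bopp_0 | now rewrite IH, bopp_add].
Qed.

Lemma vsum_ext n v w : (forall i, (i < n)%nat -> v i = w i) -> vsum n v = vsum n w.
Proof.
  induction n as [|n IH]; intros H; simpl; trivial.
  rewrite IH, (H n); auto.
Qed.

Lemma bnorm_vsum_le n v : |v vsum n v| <= fsum n (fun i => |v v i|).
Proof.
  induction n as [|n IH]; simpl; [rewrite bnorm_0; lra |].
  eapply Rle_trans; [apply bnorm_triangle | lra].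
Qed.

Lemma bnorm_weighted_le n w v : (forall i, (i < n)%nat -> 0 <= w i) ->
  |v vsum n (fun i => w i *v v i)| <= fsum n (fun i => w i * |v v i|).
Proof.
  intros hw. eapply Rle_trans; [apply bnorm_vsum_le |].
  right; apply fsum_ext; intros. rewrite bnorm_scal, Rabs_pos_eq; auto.
Qed.

Lemma norm_pow_weighted_le n w v p : 1 <= p ->
  (forall i, (i < n)%nat -> 0 <= w i) -> fsum n w = 1 ->
  rpow (|v vsum n (fun i => w i *v v i)|) p <= fsum n (fun i => w i * rpow (|v v i|) p).
Proof.
  intros hp hw hw1. eapply Rle_trans; [apply rpow_le; [lra | now apply bnorm_weighted_le] |].
  apply rpow_jensen; auto using bnorm_nonneg.
Qed.

(** The point [x] is the barycentre of the points [x +v Y i]. For martingales this is the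
    submartingale property of the [p]-th power of the norm. *)
Lemma norm_pow_le_centered n w Y x p : 1 <= p ->
  (forall i, (i < n)%nat -> 0 <= w i) -> fsum n w = 1 ->
  vsum n (fun i => w i *v Y i) = 0v ->
  rpow (|v x|) p <= fsum n (fun i => w i * rpow (|v x +v Y i|) p).
Proof.
  intros hp hw hw1 h0.
  replace x with (vsum n (fun i => w i *v (x +v Y i))) at 1; [now apply norm_pow_weighted_le |].
  rewrite (vsum_ext n _ (fun i => w i *v x +v w i *v Y i)) by (intros; apply bscal_distr_v).
  now rewrite vsum_add, vsum_scal_l, h0, hw1, badd_0_r, bscal_1.
Qed.

Section Smooth.
Context (p S : R) (hp : 1 < p <= 2) (hS : smooth_with Z p S).

(* The smoothness condition at [eps = 2], [x = y]. *)
Lemma smooth_const_ge x : |v x| = 1 -> / 4 <= rpow S p.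
Proof.
  intros hx. assert (h := hS 2 x x ltac:(lra) hx hx).
  assert (h1 : |v x +v 2 *v x| = 3).
  { rewrite <- (bscal_1 Z x) at 1. rewrite <- bscal_distr_s, bnorm_scal, hx, Rabs_pos_eq; lra. }
  assert (h2 : |v bsub Z x (2 *v x)| = 1).
  { unfold bsub. rewrite bopp_scal, bscal_assoc. rewrite <- (bscal_1 Z x) at 1.
    rewrite <- bscal_distr_s, bnorm_scal, hx, Rabs_left; lra. }
  rewrite h1, h2 in h.
  assert (h3 := rpow_exp_le 2 p 2 ltac:(lra) ltac:(lra)). rewrite rpow_2_r in h3 by lra.
  assert (h4 := rpow_nonneg S p). nra.
Qed.

(** Homogeneity removes the unit vectors: the condition is used at [eps] equal to the ratio of the
    two norms. *)
Lemma smooth_unnormalized x y : 0 < |v x| -> 0 < |v y| ->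
  (|v x +v y| + |v bsub Z x y|) / 2
    <= |v x| * (1 + rpow S p * rpow (|v y| / |v x|) p).
Proof.
  intros hx hy. set (a := |v x|) in *. set (h := |v y|) in *.
  assert (hia : 0 < / a) by now apply Rinv_0_lt_compat.
  assert (hih : 0 < / h) by now apply Rinv_0_lt_compat.
  assert (hs := hS (h / a) (/ a *v x) (/ h *v y)
    ltac:(apply Rdiv_lt_0_compat; assumption)
    ltac:(rewrite bnorm_scal, Rabs_pos_eq by lra; fold a; field; lra)
    ltac:(rewrite bnorm_scal, Rabs_pos_eq by lra; fold h; field; lra)).
  assert (e1 : / a *v x +v h / a *v (/ h *v y) = / a *v (x +v y)).
  { rewrite bscal_distr_v, bscal_assoc. do 2 f_equal. field; lra. }
  assert (e2 : bsub Z (/ a *v x) (h / a *v (/ h *v y)) = / a *v (bsub Z x y)).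
  { unfold bsub. rewrite bscal_distr_v, bscal_assoc, bscal_opp. do 3 f_equal. field; lra. }
  rewrite e1, e2, !bnorm_scal, Rabs_pos_eq in hs by lra.
  apply Rmult_le_compat_l with (r := a) in hs; [| lra].
  apply Rplus_le_reg_r with (- a).
  replace ((|v x +v y| + |v bsub Z x y|) / 2 + - a) with
    (a * ((/ a * |v x +v y| + / a * |v bsub Z x y|) / 2 - 1)) by (field; lra).
  lra.
Qed.

(** Smoothness controls only the mean [A] of the two norms. Their half-difference [e] is at most the
    norm of [y], and [rpow_two_point] passes from [A] and [e] to [p]-th powers. The worst total is
    [(2 * s + 3) * H], and [/ 4 <= s] turns it into [14 * s * H]. *)
Lemma smooth_two_point x y :
  (rpow (|v x +v y|) p + rpow (|v bsub Z x y|) p) / 2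
    <= rpow (|v x|) p + 14 * rpow S p * rpow (|v y|) p.
Proof.
  assert (hsg := rpow_nonneg S p).
  destruct (bnorm_nonneg y) as [hy | hy].
  2: { symmetry in hy. rewrite (bnorm_eq0 Z y hy). unfold bsub.
       rewrite bopp_0, badd_0_r, bnorm_0, rpow_0_l. lra. }
  assert (hs4 : / 4 <= rpow S p).
  { apply (smooth_const_ge (/ |v y| *v y)). rewrite bnorm_scal, Rabs_pos_eq.
    - field; lra.
    - left; now apply Rinv_0_lt_compat. }
  set (s := rpow S p) in *.
  set (b1 := |v x +v y|). set (b2 := |v bsub Z x y|).
  assert (hb1 : 0 <= b1) by apply bnorm_nonneg. assert (hb2 : 0 <= b2) by apply bnorm_nonneg.
  assert (h1 : b1 <= |v x| + |v y|) by apply bnorm_triangle.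
  assert (h2 : b2 <= |v x| + |v y|).
  { unfold b2, bsub. rewrite <- (bnorm_opp y). apply bnorm_triangle. }
  assert (h12 : b1 <= b2 + 2 * |v y|).
  { unfold b1, b2. replace (x +v y) with (bsub Z x y +v 2 *v y).
    - eapply Rle_trans; [apply bnorm_triangle |].
      rewrite bnorm_scal, (Rabs_pos_eq 2) by lra. lra.
    - unfold bsub. rewrite bopp_scal, <- badd_assoc, <- bscal_distr_s.
      replace (-1 + 2) with 1 by ring. now rewrite bscal_1. }
  assert (h21 : b2 <= b1 + 2 * |v y|).
  { unfold b1, b2. replace (bsub Z x y) with (x +v y +v (-2) *v y).
    - eapply Rle_trans; [apply bnorm_triangle |].
      rewrite bnorm_scal, (Rabs_left (-2)) by lra. lra.
    - unfold bsub. rewrite <- badd_assoc. f_equal. rewrite bopp_scal.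
      rewrite <- (bscal_1 Z y) at 1. rewrite <- bscal_distr_s. f_equal; ring. }
  set (A := (b1 + b2) / 2). set (e := Rabs (b1 - b2) / 2).
  assert (he : 0 <= e <= A /\ e <= |v y|).
  { unfold e, A. split_Rabs; lra. }
  assert (hsum : (rpow b1 p + rpow b2 p) / 2 <= rpow A p + rpow e p).
  { eapply Rle_trans; [| apply rpow_two_point; [tauto | lra]]. right.
    unfold e, A, Rabs. destruct (Rcase_abs (b1 - b2));
      [ replace ((b1 + b2) / 2 + - (b1 - b2) / 2) with b2 by field;
        replace ((b1 + b2) / 2 - - (b1 - b2) / 2) with b1 by field
      | replace ((b1 + b2) / 2 + (b1 - b2) / 2) with b1 by field;
        replace ((b1 + b2) / 2 - (b1 - b2) / 2) with b2 by field ]; lra. }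
  assert (he2 : rpow e p <= rpow (|v y|) p) by (apply rpow_le; lra).
  set (H := rpow (|v y|) p) in *. assert (hH : 0 <= H) by apply rpow_nonneg.
  assert (hA : rpow A p <= rpow (|v x|) p + (2 * s + 2) * H \/
               rpow A p <= rpow (|v x|) p + 3 * s * H).
  { destruct (bnorm_nonneg x) as [hx | hx].
    2: { left. rewrite <- hx, rpow_0_l. assert (rpow A p <= H) by (apply rpow_le; unfold A; lra).
         nra. }
    assert (hr : rpow (|v y| / |v x|) p = H / rpow (|v x|) p).
    { unfold Rdiv. rewrite rpow_mult, rpow_inv; trivial; [lra |].
      left; now apply Rinv_0_lt_compat. }
    assert (hU := smooth_unnormalized x y hx hy). fold b1 b2 A s in hU. rewrite hr in hU.
    assert (hX := rpow_pos (|v x|) p hx).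
    set (X := rpow (|v x|) p) in *.
    set (z := s * (H / X)) in *.
    assert (hz : 0 <= z).
    { unfold z. apply Rmult_le_pos; trivial. apply Rmult_le_pos; trivial.
      left; now apply Rinv_0_lt_compat. }
    assert (hzX : z * X = s * H) by (unfold z; field; lra).
    (* For [z <= 1], [(1 + z)^p <= (1 + z)^2 <= 1 + 3 * z]. For [z > 1], [X < s * H], so the
       triangle inequality costs only multiples of [H]. *)
    destruct (Rle_lt_dec z 1) as [hz1 | hz1].
    - right. eapply Rle_trans; [apply rpow_le; [lra | exact hU] |].
      rewrite rpow_mult by lra. fold X.
      assert (h3 := rpow_exp_le (1 + z) p 2 ltac:(lra) ltac:(lra)).
      rewrite rpow_2_r in h3 by lra.
      apply Rle_trans with (X * (1 + 3 * z)); [apply Rmult_le_compat_l; nra | lra].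
    - left. assert (h3 : rpow A p <= 2 * (X + H)).
      { eapply Rle_trans; [apply rpow_le with (y := |v x| + |v y|); [lra | unfold A; lra] |].
        apply rpow_add_le; lra. }
      nra. }
  destruct hA; nra.
Qed.

(* Jensen bounds the average over [x - Y i] from below, which turns the two-point
   inequality into a one-sided bound without any symmetrization constant. *)
Lemma smooth_centered n w Y x :
  (forall i, (i < n)%nat -> 0 <= w i) -> fsum n w = 1 ->
  vsum n (fun i => w i *v Y i) = 0v ->
  fsum n (fun i => w i * rpow (|v x +v Y i|) p)
    <= rpow (|v x|) p + 28 * rpow S p * fsum n (fun i => w i * rpow (|v Y i|) p).
Proof.
  intros hw hw1 h0.
  assert (hl := norm_pow_le_centered n w (fun i => -v (Y i)) x p ltac:(lra) hw hw1).
  assert (h0' : vsum n (fun i => w i *v (-v (Y i))) = 0v).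
  { rewrite (vsum_ext n _ (fun i => -v (w i *v Y i))) by (intros; apply bscal_opp).
    now rewrite vsum_opp, h0, bopp_0. }
  specialize (hl h0').
  assert (h2 : fsum n (fun i => w i * rpow (|v x +v Y i|) p)
             + fsum n (fun i => w i * rpow (|v x +v -v (Y i)|) p)
             <= fsum n (fun i => (2 * rpow (|v x|) p) * w i
                              + (28 * rpow S p) * (w i * rpow (|v Y i|) p))).
  { rewrite <- fsum_plus. apply fsum_le; intros i hi.
    assert (h := smooth_two_point x (Y i)). unfold bsub in h. specialize (hw i hi). nra. }
  rewrite fsum_plus, !fsum_scal, hw1 in h2. lra.
Qed.

End Smooth.
End Vectors.

(** * Markov chains and tails of their martingales *)

Definition indic (u r : R) : R := if Rle_dec u r then 1 else 0.

Lemma indic_le1 u r : indic u r <= 1.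
Proof. unfold indic; destruct (Rle_dec u r); lra. Qed.

Lemma indic_nonneg u r : 0 <= indic u r.
Proof. unfold indic; destruct (Rle_dec u r); lra. Qed.

(** One recursion over consecutive pairs serves three monoids: martingale increments in [Z],
    products of transition probabilities, and additive functionals. Reversal then has a single proof
    for martingales and path weights. *)
Fixpoint edges {A : Type} (op : A -> A -> A) (e : A) (w : nat -> nat -> A) (l : list nat) : A :=
  match l with
  | i :: l' => match l' with
               | j :: _ => op (w i j) (edges op e w l')
               | nil => e
               end
  | nil => e
  end.

Lemma edges_snoc {A : Type} (op : A -> A -> A) (e : A)
  (assoc : forall x y z, op x (op y z) = op (op x y) z)
  (comm : forall x y, op x y = op y x) (id : forall x, op e x = x) w l i j :
  edges op e w (l ++ [i; j]) = op (edges op e w (l ++ [i])) (w i j).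
Proof.
  induction l as [|k [|k' l] IH].
  - simpl. apply comm.
  - simpl. rewrite !(comm _ e), !id. reflexivity.
  - change (edges op e w ((k :: k' :: l) ++ [i; j]))
      with (op (w k k') (edges op e w ((k' :: l) ++ [i; j]))).
    rewrite IH. apply assoc.
Qed.

Lemma edges_rev {A : Type} (op : A -> A -> A) (e : A)
  (assoc : forall x y z, op x (op y z) = op (op x y) z)
  (comm : forall x y, op x y = op y x) (id : forall x, op e x = x) w l :
  edges op e w (rev l) = edges op e (fun i j => w j i) l.
Proof.
  induction l as [|i [|j l] IH]; trivial.
  change (rev (i :: j :: l)) with ((rev l ++ [j]) ++ [i]).
  rewrite <- app_assoc. simpl app. rewrite edges_snoc by assumption.
  change (rev l ++ [j]) with (rev (j :: l)). rewrite IH. apply comm.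
Qed.

Lemma hd_rev (l : list nat) : hd 0%nat (rev l) = last l 0%nat.
Proof.
  induction l as [|i [|j l] IH]; trivial.
  change (last (i :: j :: l) 0%nat) with (last (j :: l) 0%nat). rewrite <- IH.
  change (rev (i :: j :: l)) with (rev (j :: l) ++ [i]).
  destruct (rev (j :: l)) as [|a m] eqn:E; trivial.
  apply (f_equal (@length nat)) in E. rewrite length_rev in E. discriminate.
Qed.

Lemma last_lt n (l : list nat) : l <> nil -> Forall (fun i => (i < n)%nat) l ->
  (last l 0 < n)%nat.
Proof.
  intros h H. rewrite Forall_forall in H. apply H.
  destruct (exists_last h) as [l' [a ->]]. rewrite last_last. apply in_or_app. simpl; auto.
Qed.

(** The final state is not counted: along [Z_0, ..., Z_t] this is a predictable sum up to time
    [t - 1]. *)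
Definition visit_sum (a : nat -> R) : list nat -> R := edges Rplus 0 (fun i _ => a i).

Lemma visit_sum_nonneg n a l : (forall i, (i < n)%nat -> 0 <= a i) ->
  Forall (fun i => (i < n)%nat) l -> 0 <= visit_sum a l.
Proof.
  intros ha. unfold visit_sum. induction l as [|i [|j l] IH]; intros hl; [simpl; lra .. |].
  change (0 <= a i + edges Rplus 0 (fun i _ => a i) (j :: l)).
  inversion hl; subst. specialize (IH ltac:(assumption)). specialize (ha i ltac:(assumption)). lra.
Qed.

Lemma visit_sum_scal c a l : visit_sum (fun i => c * a i) l = c * visit_sum a l.
Proof.
  unfold visit_sum. induction l as [|i [|j l] IH]; simpl; [ring .. |].
  simpl in IH. rewrite IH; ring.
Qed.

Section Chain.
Context (n : nat) (P : nat -> nat -> R).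
Context (hP0 : forall i j, (i < n)%nat -> (j < n)%nat -> 0 <= P i j).
Context (hP1 : forall i, (i < n)%nat -> fsum n (fun j => P i j) = 1).

(* [G] receives the path [Z_1; ...; Z_k] without the starting state [Z_0 = i]. *)
Fixpoint expect (k i : nat) (G : list nat -> R) : R :=
  match k with
  | O => G nil
  | S k' => fsum n (fun j => P i j * expect k' j (fun l => G (j :: l)))
  end.

Lemma expect_le k : forall i G H, (i < n)%nat ->
  (forall l, length l = k -> Forall (fun j => (j < n)%nat) l -> G l <= H l) ->
  expect k i G <= expect k i H.
Proof.
  induction k as [|k IH]; intros i G H hi hGH; simpl; [apply hGH; auto |].
  apply fsum_le; intros j hj. apply Rmult_le_compat_l; [auto |].
  apply IH; trivial. intros l hl hF. apply hGH; simpl; auto.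
Qed.

Lemma expect_ext k i G H : (forall l, G l = H l) -> (i < n)%nat ->
  expect k i G = expect k i H.
Proof. intros h hi. apply Rle_antisym; apply expect_le; trivial; intros; rewrite h; lra. Qed.

Lemma expect_plus k : forall i G H,
  expect k i (fun l => G l + H l) = expect k i G + expect k i H.
Proof.
  induction k as [|k IH]; intros i G H; simpl; trivial.
  rewrite <- fsum_plus. apply fsum_ext; intros. rewrite IH; ring.
Qed.

Lemma expect_scal k : forall i c G, expect k i (fun l => c * G l) = c * expect k i G.
Proof.
  induction k as [|k IH]; intros i c G; simpl; trivial.
  rewrite <- fsum_scal. apply fsum_ext; intros. rewrite IH; ring.
Qed.

Lemma expect_const k : forall i c, (i < n)%nat -> expect k i (fun _ => c) = c.
Proof.
  induction k as [|k IH]; intros i c hi; simpl; trivial.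
  rewrite (fsum_ext n _ (fun j => P i j * c)) by (intros; now rewrite IH).
  rewrite fsum_scal_r, hP1 by assumption. ring.
Qed.

Lemma expect_nonneg k i G : (i < n)%nat ->
  (forall l, length l = k -> Forall (fun j => (j < n)%nat) l -> 0 <= G l) -> 0 <= expect k i G.
Proof. intros hi h. rewrite <- (expect_const k i 0 hi). now apply expect_le. Qed.

(** * Tail bound for a martingale driven by the chain *)

Section Tail.
Context {Z : Banach} (p S : R) (hp : 1 < p <= 2) (hS : smooth_with Z p S).
Context (Y : nat -> nat -> Z) (a e : nat -> R).
Context (hY : forall i, (i < n)%nat -> vsum n (fun j => bscal Z (P i j) (Y i j)) = bzero Z).
Context (ha : forall i, (i < n)%nat ->
  (56 * rpow S p + 8) * fsum n (fun j => P i j * rpow (bnorm Z (Y i j)) p) <= a i).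
Context (he : forall i, (i < n)%nat ->
  fsum n (fun j => P i j * trunc_sqr (rpow (bnorm Z (Y i j)) p)) <= e i).

Let V (x : Z) : R := rpow (bnorm Z x) p.
(** The cap 2 keeps the cross term bounded when a jump carries [v] far beyond 1. The term [- A ^ 2]
    absorbs the errors produced when [A] grows in the cross term. *)
Let Phi (v A : R) : R := trunc_sqr v - Rmin v 2 * A - A ^ 2.

Let Ymoment_nonneg i : (i < n)%nat -> 0 <= fsum n (fun j => P i j * V (Y i j)).
Proof. intros hi. apply fsum_nonneg; intros. apply Rmult_le_pos; auto. apply rpow_nonneg. Qed.

Let a_nonneg i : (i < n)%nat -> 0 <= a i.
Proof.
  intros hi. eapply Rle_trans; [| now apply ha].
  apply Rmult_le_pos; [pose proof (rpow_nonneg S p); lra | now apply Ymoment_nonneg].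
Qed.

Let e_nonneg i : (i < n)%nat -> 0 <= e i.
Proof.
  intros hi. eapply Rle_trans; [| now apply he].
  apply fsum_nonneg; intros. apply Rmult_le_pos; auto. apply trunc_sqr_nonneg.
Qed.

(* The cross term [- min(v,2) A] pays for the drift [v a] of [v^2]; it is a legitimate
   potential because [|M|^p] is a submartingale. *)
Lemma potential_step i x A : (i < n)%nat -> V x < 1 -> 0 <= A ->
  fsum n (fun j => P i j * Phi (V (badd Z x (Y i j))) (A + a i))
    <= (V x) ^ 2 - V x * A - A ^ 2 + 2 * e i.
Proof.
  intros hi hv hA. set (v := V x) in *.
  assert (hv0 : 0 <= v) by apply rpow_nonneg.
  assert (ha0 := a_nonneg i hi). assert (hE0 := Ymoment_nonneg i hi).
  specialize (ha i hi). specialize (he i hi).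
  assert (hlo := norm_pow_le_centered n (P i) (Y i) x p ltac:(lra)
    (fun j hj => hP0 i j hi hj) (hP1 i hi) (hY i hi)).
  assert (hup := smooth_centered p S hp hS n (P i) (Y i) x
    (fun j hj => hP0 i j hi hj) (hP1 i hi) (hY i hi)).
  fold (V x) in hlo, hup. fold v in hlo, hup.
  set (W := fsum n (fun j => P i j * rpow (bnorm Z (badd Z x (Y i j))) p)) in *.
  set (E := fsum n (fun j => P i j * rpow (bnorm Z (Y i j)) p)) in *.
  change (0 <= E) in hE0.
  set (T := fsum n (fun j => P i j * trunc_sqr (rpow (bnorm Z (Y i j)) p))) in *.
  assert (hsum : fsum n (fun j => P i j * Phi (V (badd Z x (Y i j))) (A + a i))
    <= (- v ^ 2 - (A + a i) ^ 2) + (2 * v - (A + a i)) * W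
       + (8 * v + 2 * (A + a i)) * E + 2 * T).
  { apply Rle_trans with (fsum n (fun j =>
      (- v ^ 2 - (A + a i) ^ 2) * P i j
      + (2 * v - (A + a i)) * (P i j * rpow (bnorm Z (badd Z x (Y i j))) p)
      + (8 * v + 2 * (A + a i)) * (P i j * rpow (bnorm Z (Y i j)) p)
      + 2 * (P i j * trunc_sqr (rpow (bnorm Z (Y i j)) p)))).
    2: { rewrite !fsum_plus, !fsum_scal, hP1 by assumption. fold W E T. lra. }
    apply fsum_le; intros j hj.
    assert (hPij := hP0 i j hi hj).
    set (y := Y i j). fold (V (badd Z x y)) (V y).
    assert (hh : 0 <= V y) by apply rpow_nonneg.
    assert (hw : 0 <= V (badd Z x y)) by apply rpow_nonneg.
    assert (ht1 : bnorm Z x <= bnorm Z (badd Z x y) + bnorm Z y) by apply bnorm_le_add.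
    assert (ht2 : bnorm Z (badd Z x y) <= bnorm Z x + bnorm Z y) by apply bnorm_triangle.
    assert (h1 : trunc_sqr (V (badd Z x y)) <= v * v + 2 * v * (V (badd Z x y) - v)
      + 8 * v * V y + 2 * trunc_sqr (V y)).
    { apply trunc_sqr_step; trivial; [lra |].
      apply rpow_increment_sqr; trivial; apply bnorm_nonneg. }
    assert (h2 : V (badd Z x y) <= 2 * (v + V y)).
    { unfold V at 1. eapply Rle_trans; [apply rpow_le; [lra | exact ht2] |].
      apply rpow_add_le; trivial; apply bnorm_nonneg. }
    (* As [v < 1], [h2] gives [w < 2 + 2 * h]; this is why the cap in [Phi] is 2. *)
    assert (h3 : V (badd Z x y) - 2 * V y <= Rmin (V (badd Z x y)) 2) by (apply Rmin_glb; lra).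
    unfold Phi.
    set (w := V (badd Z x y)) in *. set (h := V y) in *.
    apply Rle_trans with (P i j * ((- v ^ 2 - (A + a i) ^ 2) + (2 * v - (A + a i)) * w
      + (8 * v + 2 * (A + a i)) * h + 2 * trunc_sqr h)); [| right; ring].
    apply Rmult_le_compat_l; trivial.
    apply Rmult_le_compat_r with (r := A + a i) in h3; [| lra]. lra. }
  eapply Rle_trans; [exact hsum |].
  assert (hs := rpow_nonneg S p).
  set (s := rpow S p) in *.
  (* With [W - v <= 28 * s * E] the left side is at most [v * (56 * s + 8) * E], the origin of the
     coefficient in [ha]. *)
  assert (h1 : 2 * v * (W - v) + 8 * v * E <= v * a i) by nra.
  assert (h2 : 8 * E <= a i) by nra.
  (* Uses the submartingale bound [v <= W] and [2 * E <= a i]. The loss [(A + a i) * a i] is then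
     absorbed by [- (A + a i) ^ 2]. *)
  assert (h3 : (A + a i) * (v - a i) <= (A + a i) * (W - 2 * E)).
  { apply Rmult_le_compat_l; lra. }
  nra.
Qed.

(** Optional stopping by induction on the first step: [x] and [A] are the current position and
    compensator. Stopping occurs when [V x >= 1] or when [A] is about to pass [/ 5]; in both cases
    the right side is already at least 1, so no stopping time has to be formalised. *)
Lemma martingale_tail k : forall i x A, (i < n)%nat -> 0 <= A <= / 5 ->
  expect k i (fun l => indic 1 (bnorm Z (badd Z x (edges (badd Z) (bzero Z) Y (i :: l)))))
    <= 2 * Phi (V x) A
       + 28 * expect k i (fun l => trunc_sqr (A + visit_sum a (i :: l)))
       + 4 * expect k i (fun l => visit_sum e (i :: l)).
Proof.
  induction k as [|k IH]; intros i x A hi hA.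
  all: assert (hv0 : 0 <= V x) by apply rpow_nonneg.
  all: assert (hT0 : forall k', 0 <= expect k' i (fun l => trunc_sqr (A + visit_sum a (i :: l))))
    by (intros; apply expect_nonneg; auto using trunc_sqr_nonneg).
  all: assert (he0 : forall k', 0 <= expect k' i (fun l => visit_sum e (i :: l)))
    by (intros; apply expect_nonneg; trivial; intros; apply visit_sum_nonneg with n; auto).
  (* From [A <= / 5]: [1 - 2 * A - A^2 >= 14/25 >= 1/2]. *)
  all: assert (hbig : 1 <= V x -> 1 <= 2 * Phi (V x) A).
  1, 3: intros h1; unfold Phi; rewrite trunc_sqr_large by assumption;
    assert (hm := Rmin_r (V x) 2); assert (hm0 : 0 <= Rmin (V x) 2) by (apply Rmin_glb; lra); nra.
  - simpl expect in *. rewrite badd_0_r.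
    change (visit_sum e [i]) with 0. change (visit_sum a [i]) with 0. rewrite Rplus_0_r.
    unfold indic. destruct (Rle_dec 1 (bnorm Z x)) as [h|h].
    + assert (h1 : 1 <= V x) by (rewrite <- (rpow_1_l p); apply rpow_le; lra).
      specialize (hbig h1). pose proof (trunc_sqr_nonneg A). lra.
    + assert (h1 : V x < 1).
      { rewrite <- (rpow_1_l p). apply rpow_lt; [lra | apply bnorm_nonneg | lra]. }
      unfold Phi. rewrite !trunc_sqr_small, Rmin_left by lra. nra.
  - destruct (Rle_lt_dec 1 (V x)) as [h1|h1].
    + specialize (hbig h1). specialize (hT0 (Datatypes.S k)). specialize (he0 (Datatypes.S k)).
      assert (h : expect (Datatypes.S k) i
        (fun l => indic 1 (bnorm Z (badd Z x (edges (badd Z) (bzero Z) Y (i :: l))))) <= 1).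
      { rewrite <- (expect_const (Datatypes.S k) i 1 hi). apply expect_le; auto using indic_le1. }
      lra.
    + assert (ha0 := a_nonneg i hi).
      assert (hPhi : Phi (V x) A = V x ^ 2 - V x * A - A ^ 2).
      { unfold Phi. rewrite trunc_sqr_small, Rmin_left by lra. ring. }
      destruct (Rle_lt_dec (A + a i) (/ 5)) as [h5|h5].
      * assert (hstep := potential_step i x A hi h1 ltac:(lra)).
        assert (hE : expect (Datatypes.S k) i (fun l => visit_sum e (i :: l))
          = e i + fsum n (fun j => P i j * expect k j (fun l => visit_sum e (j :: l)))).
        { simpl. rewrite <- (Rmult_1_r (e i)), <- (hP1 i hi), <- fsum_scal, <- fsum_plus.
          apply fsum_ext; intros j hj.
          change (fun l => visit_sum e (i :: j :: l)) with (fun l => e i + visit_sum e (j :: l)).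
          rewrite expect_plus, expect_const by assumption. ring. }
        rewrite hE. simpl expect. rewrite hPhi.
        assert (hIH : fsum n (fun j => P i j * expect k j (fun l =>
            indic 1 (bnorm Z (badd Z x (edges (badd Z) (bzero Z) Y (i :: j :: l))))))
          <= fsum n (fun j => 2 * (P i j * Phi (V (badd Z x (Y i j))) (A + a i))
             + 28 * (P i j * expect k j (fun l => trunc_sqr (A + visit_sum a (i :: j :: l))))
             + 4 * (P i j * expect k j (fun l => visit_sum e (j :: l))))).
        { apply fsum_le; intros j hj.
          assert (hPij := hP0 i j hi hj).
          specialize (IH j (badd Z x (Y i j)) (A + a i) hj ltac:(lra)).
          apply Rmult_le_compat_l with (r := P i j) in IH; trivial.
          rewrite (expect_ext k j (fun l => trunc_sqr (A + a i + visit_sum a (j :: l)))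
            (fun l => trunc_sqr (A + visit_sum a (i :: j :: l)))) in IH; trivial.
          2: { intros l. f_equal. change (visit_sum a (i :: j :: l)) with (a i + visit_sum a (j :: l)).
               ring. }
          rewrite (expect_ext k j _ (fun l => indic 1 (bnorm Z (badd Z x
            (edges (badd Z) (bzero Z) Y (i :: j :: l)))))) in IH; trivial.
          2: { intros l. do 2 f_equal.
               change (edges (badd Z) (bzero Z) Y (i :: j :: l))
                 with (badd Z (Y i j) (edges (badd Z) (bzero Z) Y (j :: l))).
               symmetry; apply badd_assoc. }
          eapply Rle_trans; [exact IH | right; ring]. }
        rewrite !fsum_plus, !fsum_scal in hIH.
        eapply Rle_trans; [exact hIH | lra].
      (* The compensator passes [/ 5], so the truncated square contributes at least [28/25], while
         completing the square gives [2 * Phi >= - (5/2) * A^2 >= - 1/10]. This fixes the constant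
         28. *)
      * assert (h : expect (Datatypes.S k) i
        (fun l => indic 1 (bnorm Z (badd Z x (edges (badd Z) (bzero Z) Y (i :: l))))) <= 1).
        { rewrite <- (expect_const (Datatypes.S k) i 1 hi). apply expect_le; auto using indic_le1. }
        assert (hT : / 25 <= expect (Datatypes.S k) i (fun l => trunc_sqr (A + visit_sum a (i :: l)))).
        { rewrite <- (expect_const (Datatypes.S k) i (/ 25) hi). apply expect_le; trivial.
          intros [|j l] hl hF; [discriminate |].
          change (visit_sum a (i :: j :: l)) with (a i + visit_sum a (j :: l)).
          assert (0 <= visit_sum a (j :: l)) by (apply visit_sum_nonneg with n; auto).
          replace (/ 25) with (trunc_sqr (/ 5)) by (rewrite trunc_sqr_small; lra).
          apply trunc_sqr_mono; lra. }
        specialize (he0 (Datatypes.S k)). rewrite hPhi.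
        assert (hsq := pow2_ge_0 (V x - A / 2)).
        assert (hA2 : A ^ 2 <= / 25) by nra.
        lra.
Qed.

Lemma martingale_tail_0 k i : (i < n)%nat ->
  expect k i (fun l => indic 1 (bnorm Z (edges (badd Z) (bzero Z) Y (i :: l))))
    <= 28 * expect k i (fun l => trunc_sqr (visit_sum a (i :: l)))
       + 4 * expect k i (fun l => visit_sum e (i :: l)).
Proof.
  intros hi. assert (h := martingale_tail k i (bzero Z) 0 hi ltac:(lra)).
  rewrite (expect_ext k i _ (fun l => indic 1 (bnorm Z (edges (badd Z) (bzero Z) Y (i :: l)))))
    in h by (trivial; intros; now rewrite badd_0).
  rewrite (expect_ext k i (fun l => trunc_sqr _) (fun l => trunc_sqr (visit_sum a (i :: l))))
    in h by (trivial; intros; now rewrite Rplus_0_l).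
  unfold V, Phi in h. rewrite bnorm_0, rpow_0_l, trunc_sqr_small in h by lra. lra.
Qed.

End Tail.
(** [expect] unfolds at the first step of the path, [mpow] at the last; this lemma reconciles the
    two. *)
Lemma expect_last_step k : forall i g, (i < n)%nat ->
  expect (S k) i (fun l => g (last (i :: l) 0%nat))
    = expect k i (fun l => fsum n (fun j => P (last (i :: l) 0%nat) j * g j)).
Proof.
  induction k as [|k IH]; intros i g hi; [reflexivity |].
  change (fsum n (fun j => P i j * expect (S k) j (fun l => g (last (j :: l) 0%nat)))
    = fsum n (fun j => P i j * expect k j (fun l =>
        fsum n (fun j' => P (last (j :: l) 0%nat) j' * g j')))).
  apply fsum_ext; intros j hj. now rewrite IH.
Qed.

Lemma expect_last k : forall i g, (i < n)%nat ->
  expect k i (fun l => g (last (i :: l) 0%nat)) = fsum n (fun j => mpow n P k i j * g j).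
Proof.
  induction k as [|k IH]; intros i g hi.
  - simpl. now rewrite fsum_delta.
  - rewrite expect_last_step by assumption.
    rewrite (IH i (fun m => fsum n (fun j => P m j * g j)) hi). simpl.
    rewrite (fsum_ext n (fun j => fsum n _ * g j)
      (fun j => fsum n (fun m => mpow n P k i m * (P m j * g j)))).
    + rewrite fsum_swap. apply fsum_ext; intros. symmetry; apply fsum_scal.
    + intros j hj. rewrite <- fsum_scal_r. apply fsum_ext; intros; ring.
Qed.

(** Unweighted summation over words, for which reversal is a mere reindexing. [expect] favours the
    starting end, so time reversal is proved after moving the transition probabilities into the
    summand. *)
Fixpoint word_sum (k : nat) (G : list nat -> R) : R :=
  match k with
  | O => G nil
  | S k' => fsum n (fun i => word_sum k' (fun l => G (i :: l)))
  end.

Lemma word_sum_ext k : forall G H,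
  (forall l, length l = k -> Forall (fun j => (j < n)%nat) l -> G l = H l) ->
  word_sum k G = word_sum k H.
Proof.
  induction k as [|k IH]; intros G H h; simpl; [apply h; auto |].
  apply fsum_ext; intros i hi. apply IH. intros l hl hF. apply h; simpl; auto.
Qed.

Lemma word_sum_scal k : forall c G, word_sum k (fun l => c * G l) = c * word_sum k G.
Proof.
  induction k as [|k IH]; intros c G; simpl; trivial.
  rewrite <- fsum_scal. apply fsum_ext; intros. apply IH.
Qed.

Lemma word_sum_fsum k : forall m G,
  word_sum k (fun l => fsum m (fun i => G i l)) = fsum m (fun i => word_sum k (G i)).
Proof.
  induction k as [|k IH]; intros m G; simpl; trivial.
  rewrite fsum_swap. apply fsum_ext; intros. apply IH.
Qed.

Lemma word_sum_snoc k : forall G,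
  word_sum (S k) G = word_sum k (fun l => fsum n (fun i => G (l ++ [i]))).
Proof.
  induction k as [|k IH]; intros G; trivial.
  change (fsum n (fun i => word_sum (S k) (fun l => G (i :: l)))
    = fsum n (fun i => word_sum k (fun l => fsum n (fun j => G ((i :: l) ++ [j]))))).
  apply fsum_ext; intros. apply IH.
Qed.

Lemma word_sum_rev k : forall G, word_sum k (fun l => G (rev l)) = word_sum k G.
Proof.
  induction k as [|k IH]; intros G; trivial.
  rewrite word_sum_snoc, word_sum_fsum. simpl.
  apply fsum_ext; intros i hi. rewrite <- (IH (fun l => G (i :: l))).
  apply word_sum_ext; intros; now rewrite rev_unit.
Qed.

Lemma expect_word_sum k : forall i G,
  expect k i G = word_sum k (fun l => edges Rmult 1 P (i :: l) * G l).
Proof.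
  induction k as [|k IH]; intros i G; simpl expect; [simpl; ring |].
  change (word_sum (S k) (fun l => edges Rmult 1 P (i :: l) * G l)) with
    (fsum n (fun j => word_sum k (fun l =>
       P i j * edges Rmult 1 P (j :: l) * G (j :: l)))).
  apply fsum_ext; intros j hj. rewrite IH, <- word_sum_scal.
  apply word_sum_ext; intros. symmetry; apply Rmult_assoc.
Qed.

(** * Stationary paths and time reversal *)

Section Reversible.
Context (pi : nat -> R).
Context (hpi0 : forall i, (i < n)%nat -> 0 <= pi i).
Context (hpi1 : fsum n pi = 1).
Context (hstat : forall j, (j < n)%nat -> fsum n (fun i => pi i * P i j) = pi j).
Context (hrev : forall i j, (i < n)%nat -> (j < n)%nat -> pi i * P i j = pi j * P j i).

(* Here [G] receives the whole path [Z_0; ...; Z_t]. *)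
Definition path_expect (t : nat) (G : list nat -> R) : R :=
  fsum n (fun i => pi i * expect t i (fun l => G (i :: l))).

Lemma path_expect_le t G H :
  (forall l, l <> nil -> Forall (fun j => (j < n)%nat) l -> G l <= H l) ->
  path_expect t G <= path_expect t H.
Proof.
  intros h. apply fsum_le; intros i hi. apply Rmult_le_compat_l; [auto |].
  apply expect_le; trivial. intros l hl hF. apply h; [discriminate | auto].
Qed.

Lemma path_expect_plus t G H :
  path_expect t (fun l => G l + H l) = path_expect t G + path_expect t H.
Proof.
  unfold path_expect. rewrite <- fsum_plus. apply fsum_ext; intros i hi.
  rewrite expect_plus. ring.
Qed.

Lemma path_expect_scal t c G : path_expect t (fun l => c * G l) = c * path_expect t G.
Proof.
  unfold path_expect. rewrite <- fsum_scal. apply fsum_ext; intros i hi.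
  rewrite expect_scal. ring.
Qed.

Lemma path_expect_const t c : path_expect t (fun _ => c) = c.
Proof.
  unfold path_expect. rewrite (fsum_ext n _ (fun i => pi i * c)).
  - rewrite fsum_scal_r, hpi1. ring.
  - intros i hi. now rewrite expect_const.
Qed.

Lemma path_expect_fsum t m (G : nat -> list nat -> R) :
  path_expect t (fun l => fsum m (fun k => G k l)) = fsum m (fun k => path_expect t (G k)).
Proof.
  induction m as [|m IH]; simpl; [apply path_expect_const |].
  now rewrite path_expect_plus, IH.
Qed.

Lemma path_expect_hd t g : path_expect t (fun l => g (hd 0%nat l)) = fsum n (fun i => pi i * g i).
Proof. apply fsum_ext; intros i hi. simpl. now rewrite expect_const. Qed.

Lemma path_expect_ends t (g : nat -> nat -> R) :
  path_expect t (fun l => g (hd 0%nat l) (last l 0%nat))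
    = fsum n (fun i => fsum n (fun j => pi i * mpow n P t i j * g i j)).
Proof.
  apply fsum_ext; intros i hi.
  change (pi i * expect t i (fun l => g i (last (i :: l) 0%nat))
    = fsum n (fun j => pi i * mpow n P t i j * g i j)).
  rewrite (expect_last t i (g i) hi), <- fsum_scal. apply fsum_ext; intros; ring.
Qed.

(** Detailed balance carries [pi] across one edge at a time, transposing that edge. *)
Lemma path_weight_rev l : Forall (fun j => (j < n)%nat) l ->
  pi (hd 0%nat l) * edges Rmult 1 P l
    = pi (last l 0%nat) * edges Rmult 1 (fun i j => P j i) l.
Proof.
  induction l as [|i [|j l] IH]; intros hF; trivial.
  change (pi i * (P i j * edges Rmult 1 P (j :: l))
    = pi (last (j :: l) 0%nat) * (P j i * edges Rmult 1 (fun i j => P j i) (j :: l))).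
  inversion hF as [|? ? hi hF']; subst. inversion hF' as [|? ? hj hF'']; subst.
  specialize (IH hF'). simpl hd in IH.
  rewrite <- Rmult_assoc, hrev by assumption.
  transitivity (P j i * (pi j * edges Rmult 1 P (j :: l))); [ring | rewrite IH; ring].
Qed.

Lemma path_expect_word_sum t G :
  path_expect t G = word_sum (S t) (fun l => pi (hd 0%nat l) * edges Rmult 1 P l * G l).
Proof.
  apply fsum_ext; intros i hi. rewrite expect_word_sum, <- word_sum_scal.
  apply word_sum_ext; intros. simpl hd. symmetry; apply Rmult_assoc.
Qed.

Lemma path_expect_rev t G : path_expect t (fun l => G (rev l)) = path_expect t G.
Proof.
  rewrite !path_expect_word_sum, <- (word_sum_rev _ (fun l => _ * G l)).
  apply word_sum_ext; intros l hl hF. f_equal. rewrite path_weight_rev by assumption.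
  rewrite hd_rev, (edges_rev Rmult 1); trivial; intros; ring.
Qed.

(** By stationarity the path after its first step again starts from [pi], so each counted visit has
    the same mean. *)
Lemma path_expect_visit_sum t a :
  path_expect t (visit_sum a) = INR t * fsum n (fun i => pi i * a i).
Proof.
  unfold path_expect. induction t as [|t IH].
  - simpl expect. rewrite Rmult_0_l. change (fun i => pi i * visit_sum a [i]) with (fun i => pi i * 0).
    rewrite fsum_scal_r; ring.
  - rewrite S_INR, Rmult_plus_distr_r, <- IH, Rmult_1_l, Rplus_comm.
    rewrite (fsum_ext n _ (fun i => pi i * a i
      + fsum n (fun j => (pi i * P i j) * expect t j (fun l => visit_sum a (j :: l))))).
    + rewrite fsum_plus, fsum_swap. f_equal. apply fsum_ext; intros j hj.
      now rewrite fsum_scal_r, hstat.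
    + intros i hi.
      change (expect (S t) i (fun l => visit_sum a (i :: l)))
        with (fsum n (fun j => P i j * expect t j (fun l => a i + visit_sum a (j :: l)))).
      rewrite (fsum_ext n (fun j => P i j * _) (fun j => a i * P i j
        + P i j * expect t j (fun l => visit_sum a (j :: l)))).
      * rewrite fsum_plus, fsum_scal, hP1 by assumption.
        rewrite Rmult_plus_distr_l, <- fsum_scal. f_equal; [ring |].
        apply fsum_ext; intros; ring.
      * intros j hj. rewrite expect_plus, expect_const by assumption. ring.
Qed.

(** * Displacement tail at a single scale *)

Section Scale.
Context {Z : Banach} (p S : R) (hp : 1 < p <= 2) (hS : smooth_with Z p S).
Context (F : nat -> Z) (r : nat -> nat -> R).
Context (hr : forall i j, rpow (bnorm Z (bsub Z (F j) (F i))) p <= r i j).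

(** Doob decomposition of [F] along the chain: [g] is the conditional drift, [Y] the martingale
    difference. The bound [r] only dominates the increments, so that it can keep one shape at all
    scales. *)
Let g (i : nat) : Z := vsum n (fun j => bscal Z (P i j) (bsub Z (F j) (F i))).
Let Y (i j : nat) : Z := bsub Z (bsub Z (F j) (F i)) (g i).
Let b (i : nat) : R := fsum n (fun j => P i j * r i j).

Let r_nonneg i j : 0 <= r i j.
Proof. eapply Rle_trans; [apply rpow_nonneg | apply hr]. Qed.

Let b_nonneg i : (i < n)%nat -> 0 <= b i.
Proof. intros; apply fsum_nonneg; intros; apply Rmult_le_pos; auto. Qed.

Let F_step i j : badd Z (badd Z (F i) (g i)) (Y i j) = F j.
Proof. unfold Y. now rewrite <- badd_assoc, !bsub_add. Qed.

Let Y_centered i : (i < n)%nat ->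
  vsum n (fun j => bscal Z (P i j) (Y i j)) = bzero Z.
Proof.
  intros hi. unfold Y.
  rewrite (vsum_ext n _ (fun j => badd Z (bscal Z (P i j) (bsub Z (F j) (F i)))
    (bopp Z (bscal Z (P i j) (g i))))).
  - rewrite vsum_add, vsum_opp, vsum_scal_l, hP1, bscal_1 by assumption. apply badd_opp_r.
  - intros j hj. unfold bsub at 1. now rewrite bscal_distr_v, bscal_opp.
Qed.

Let g_pow_le i : (i < n)%nat -> rpow (bnorm Z (g i)) p <= b i.
Proof.
  intros hi. eapply Rle_trans; [apply norm_pow_weighted_le; auto; lra |].
  apply fsum_le; intros j hj. apply Rmult_le_compat_l; auto.
Qed.

Let Y_pow_le i j : (i < n)%nat -> rpow (bnorm Z (Y i j)) p <= 2 * (r i j + b i).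
Proof.
  intros hi. unfold Y.
  apply Rle_trans with
    (rpow (bnorm Z (bsub Z (F j) (F i)) + bnorm Z (g i)) p).
  - apply rpow_le; [lra |]. unfold bsub at 1. rewrite <- (bnorm_opp (g i)). apply bnorm_triangle.
  - eapply Rle_trans; [apply rpow_add_le; auto using bnorm_nonneg |].
    specialize (hr i j). specialize (g_pow_le i hi). lra.
Qed.

(* The martingale of the reversed chain is the forward one read along the reversed path. *)
Lemma forward_backward l : l <> nil ->
  let x0 := hd 0%nat l in let xt := last l 0%nat in
  badd Z (badd Z (badd Z (F x0) (F x0)) (g x0)) (edges (badd Z) (bzero Z) Y l)
  = badd Z (badd Z (badd Z (F xt) (F xt)) (g xt)) (edges (badd Z) (bzero Z) Y (rev l)).
Proof.
  intros hl x0 xt.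
  rewrite (edges_rev (badd Z) (bzero Z) (badd_assoc Z) (badd_comm Z) (badd_0 Z)).
  subst x0 xt. induction l as [|i [|j l] IH]; [congruence | reflexivity |].
  specialize (IH ltac:(discriminate)).
  change (last (i :: j :: l) 0%nat) with (last (j :: l) 0%nat).
  change (edges (badd Z) (bzero Z) Y (i :: j :: l))
    with (badd Z (Y i j) (edges (badd Z) (bzero Z) Y (j :: l))).
  change (edges (badd Z) (bzero Z) (fun i0 j0 => Y j0 i0) (i :: j :: l))
    with (badd Z (Y j i) (edges (badd Z) (bzero Z) (fun i0 j0 => Y j0 i0) (j :: l))).
  simpl hd in *.
  (* The doubled [F i] with its drift absorbs [Y i j] and becomes [F i + F j], which is symmetric in
     the two states; this is what lets both martingales advance together. *)
  assert (H : forall i j m, badd Z (badd Z (badd Z (F i) (F i)) (g i)) (badd Z (Y i j) m)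
    = badd Z (badd Z (F i) (F j)) m).
  { intros i' j' m.
    now rewrite badd_assoc, <- (badd_assoc Z (F i')), <- (badd_assoc Z (F i')), F_step. }
  rewrite H, (badd_comm Z (Y j i)), (badd_assoc Z _ _ (Y j i)), <- IH.
  rewrite <- (badd_assoc Z _ _ (Y j i)), (badd_comm Z _ (Y j i)), H.
  now rewrite (badd_comm Z (F j)).
Qed.

Lemma ends_norm_le l : l <> nil ->
  2 * bnorm Z (bsub Z (F (last l 0%nat)) (F (hd 0%nat l)))
   <= bnorm Z (edges (badd Z) (bzero Z) Y l) + bnorm Z (edges (badd Z) (bzero Z) Y (rev l))
      + bnorm Z (g (hd 0%nat l)) + bnorm Z (g (last l 0%nat)).
Proof.
  intros hl. assert (h := forward_backward l hl). cbv zeta in h.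
  set (x0 := hd 0%nat l) in *. set (xt := last l 0%nat) in *.
  set (M := edges (badd Z) (bzero Z) Y l) in *.
  set (M' := edges (badd Z) (bzero Z) Y (rev l)) in *.
  set (D := bsub Z (F xt) (F x0)).
  rewrite <- (bsub_add (F x0) (F xt)) in h. fold D in h.
  rewrite (badd_ACA (F x0) D), <- !badd_assoc in h.
  do 2 apply badd_cancel_l in h. rewrite !badd_assoc in h.
  rewrite <- (badd_assoc Z (badd Z D D)) in h.
  assert (h1 := bnorm_le_add (badd Z D D) (badd Z (g xt) M')). rewrite <- h in h1.
  assert (h2 := bnorm_triangle Z (g x0) M). assert (h3 := bnorm_triangle Z (g xt) M').
  assert (h4 : bnorm Z (badd Z D D) = 2 * bnorm Z D).
  { rewrite <- (bscal_1 Z D) at 1 2. rewrite <- bscal_distr_s, bnorm_scal, Rabs_pos_eq; lra. }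
  lra.
Qed.

(** If the displacement is at least 2, the four norms in [ends_norm_le] add up to at least 4, so one
    of them is at least 1. Both martingales have the same tail by reversibility, which doubles 28
    and 4; a drift of norm at least 1 forces [trunc_sqr (b i) = 1]. Averaging [Y_pow_le] gives
    [4 * b i], whence [224 = 4 * 56] and [32 = 4 * 8]. *)
Lemma displacement_tail t :
  path_expect t (fun l => indic 2 (bnorm Z (bsub Z (F (last l 0%nat)) (F (hd 0%nat l)))))
  <= 56 * path_expect t (fun l => trunc_sqr ((224 * rpow S p + 32) * visit_sum b l))
     + 8 * (INR t * fsum n (fun i => pi i *
              fsum n (fun j => P i j * trunc_sqr (2 * (r i j + b i)))))
     + 2 * fsum n (fun i => pi i * trunc_sqr (b i)).
Proof.
  set (a := fun i => (224 * rpow S p + 32) * b i).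
  set (e := fun i => fsum n (fun j => P i j * trunc_sqr (2 * (r i j + b i)))).
  assert (hs := rpow_nonneg S p).
  assert (ha : forall i, (i < n)%nat ->
    (56 * rpow S p + 8) * fsum n (fun j => P i j * rpow (bnorm Z (Y i j)) p) <= a i).
  { intros i hi. unfold a. replace (224 * rpow S p + 32) with ((56 * rpow S p + 8) * 4) by ring.
    rewrite Rmult_assoc. apply Rmult_le_compat_l; [lra |].
    apply Rle_trans with (fsum n (fun j => 2 * (P i j * r i j) + (2 * b i) * P i j)).
    - apply fsum_le; intros j hj. specialize (Y_pow_le i j hi). specialize (hP0 i j hi hj). nra.
    - rewrite fsum_plus, !fsum_scal, hP1 by assumption. fold (b i). lra. }
  assert (he : forall i, (i < n)%nat ->
    fsum n (fun j => P i j * trunc_sqr (rpow (bnorm Z (Y i j)) p)) <= e i).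
  { intros i hi. apply fsum_le; intros j hj. apply Rmult_le_compat_l; [auto |].
    apply trunc_sqr_mono. split; [apply rpow_nonneg | auto]. }
  set (M := edges (badd Z) (bzero Z) Y).
  assert (hM : path_expect t (fun l => indic 1 (bnorm Z (M l)))
    <= 28 * path_expect t (fun l => trunc_sqr (visit_sum a l)) + 4 * path_expect t (visit_sum e)).
  { rewrite <- !path_expect_scal, <- path_expect_plus.
    apply fsum_le; intros i hi. apply Rmult_le_compat_l; [auto |].
    rewrite expect_plus, !expect_scal.
    apply (martingale_tail_0 p S hp hS Y a e); auto. }
  assert (hpt : forall l, l <> nil -> Forall (fun j => (j < n)%nat) l ->
    indic 2 (bnorm Z (bsub Z (F (last l 0%nat)) (F (hd 0%nat l))))
    <= indic 1 (bnorm Z (M l)) + indic 1 (bnorm Z (M (rev l)))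
       + trunc_sqr (b (hd 0%nat l)) + trunc_sqr (b (hd 0%nat (rev l)))).
  { intros l hl hF. rewrite hd_rev. assert (h := ends_norm_le l hl). fold M in h.
    assert (hx0 : (hd 0 l < n)%nat) by (destruct hF; [congruence | assumption]).
    assert (hxt := last_lt n l hl hF).
    assert (hT : forall i, (i < n)%nat -> 1 <= bnorm Z (g i) -> trunc_sqr (b i) = 1).
    { intros i hi h1. apply trunc_sqr_large. eapply Rle_trans; [| now apply g_pow_le].
      rewrite <- (rpow_1_l p). apply rpow_le; lra. }
    specialize (hT _ hx0) as hT0. specialize (hT _ hxt).
    assert (p1 := indic_nonneg 1 (bnorm Z (M l))).
    assert (p2 := indic_nonneg 1 (bnorm Z (M (rev l)))).
    assert (p3 := trunc_sqr_nonneg (b (hd 0%nat l))).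
    assert (p4 := trunc_sqr_nonneg (b (last l 0%nat))).
    unfold indic at 1. destruct (Rle_dec 2 _) as [h2|h2]; [| lra].
    destruct (Rle_lt_dec 1 (bnorm Z (g (hd 0%nat l)))) as [h3|h3]; [specialize (hT0 h3); lra |].
    destruct (Rle_lt_dec 1 (bnorm Z (g (last l 0%nat)))) as [h4|h4]; [specialize (hT h4); lra |].
    unfold indic in *.
    destruct (Rle_dec 1 (bnorm Z (M l))); [lra |].
    destruct (Rle_dec 1 (bnorm Z (M (rev l)))); lra. }
  eapply Rle_trans; [apply path_expect_le, hpt |].
  rewrite !path_expect_plus.
  rewrite (path_expect_rev t (fun l => indic 1 (bnorm Z (M l)))).
  rewrite (path_expect_rev t (fun l => trunc_sqr (b (hd 0%nat l)))).
  rewrite (path_expect_hd t (fun i => trunc_sqr (b i))).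
  rewrite path_expect_visit_sum in hM.
  assert (heq : path_expect t (fun l => trunc_sqr (visit_sum a l))
    <= path_expect t (fun l => trunc_sqr ((224 * rpow S p + 32) * visit_sum b l))).
  { apply path_expect_le; intros. unfold a. rewrite visit_sum_scal. lra. }
  fold (e) in hM |- *. change (fun i => pi i * fsum n _) with (fun i => pi i * e i). lra.
Qed.

End Scale.
End Reversible.
End Chain.

Lemma visit_sum_ext a a' l : (forall i, a i = a' i) -> visit_sum a l = visit_sum a' l.
Proof.
  intros h. unfold visit_sum. induction l as [|i [|j l] IH]; trivial.
  simpl in *. now rewrite IH, h.
Qed.

(** * Summation over dyadic scales *)

(* Telescopes against [6 al u / (al + u)] at [u = de 2^m]. *)
Lemma dyadic_trunc_sqr_sum de al N : 0 < de -> 0 <= al ->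
  fsum N (fun m => de * 2 ^ m * trunc_sqr (al / (de * 2 ^ m))) <= 6 * al.
Proof.
  intros hde [hal | <-].
  2: { rewrite (fsum_ext N _ (fun _ => 0)), fsum_0; [lra |].
       intros. unfold Rdiv. rewrite Rmult_0_l, trunc_sqr_small; lra. }
  assert (h : fsum N (fun m => de * 2 ^ m * trunc_sqr (al / (de * 2 ^ m)))
    <= 6 * al * (de * 2 ^ N) / (al + de * 2 ^ N)).
  { induction N as [|N IH].
    - simpl. apply Rmult_le_pos; [nra | left; apply Rinv_0_lt_compat; nra].
    - simpl fsum. replace (de * 2 ^ S N) with (2 * (de * 2 ^ N)) by (simpl; ring).
      assert (hu : 0 < de * 2 ^ N) by (apply Rmult_lt_0_compat; trivial; apply pow_lt; lra).
      set (u := de * 2 ^ N) in *.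
      eapply Rle_trans; [apply Rplus_le_compat_r, IH |].
      (* The increment of [6 al u / (al + u)] from [u] to [2 u] is
         [6 al^2 u / ((al + u) (al + 2 u))]. *)
      assert (hT : u * trunc_sqr (al / u) * ((al + u) * (al + 2 * u)) <= 6 * al ^ 2 * u).
      { destruct (Rle_lt_dec u al) as [h1|h1].
        - assert (u * trunc_sqr (al / u) <= u * 1)
            by (apply Rmult_le_compat_l; [lra | apply trunc_sqr_le1]).
          apply Rle_trans with (u * 1 * ((al + u) * (al + 2 * u))).
          + apply Rmult_le_compat_r; nra.
          + assert ((al + u) * (al + 2 * u) <= 6 * al ^ 2) by nra. nra.
        - assert (u * trunc_sqr (al / u) <= al ^ 2 * / u).
          { apply Rle_trans with (u * (al / u * (al / u))).
            - apply Rmult_le_compat_l; [lra | apply trunc_sqr_le_sqr].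
            - right. field; lra. }
          apply Rle_trans with (al ^ 2 * / u * (6 * u ^ 2)).
          + apply Rmult_le_compat; trivial; try nra.
            apply Rmult_le_pos; [lra | apply trunc_sqr_nonneg].
          + right. field; lra. }
      assert (hpos : 0 < (al + u) * (al + 2 * u)) by nra.
      apply Rmult_le_reg_r with ((al + u) * (al + 2 * u)); trivial.
      replace ((6 * al * u / (al + u) + u * trunc_sqr (al / u)) * ((al + u) * (al + 2 * u)))
        with (6 * al * u * (al + 2 * u) + u * trunc_sqr (al / u) * ((al + u) * (al + 2 * u)))
        by (field; lra).
      replace (6 * al * (2 * u) / (al + 2 * u) * ((al + u) * (al + 2 * u)))
        with (12 * al * u * (al + u)) by (field; lra).
      lra. }
  eapply Rle_trans; [exact h |].
  assert (hu : 0 < de * 2 ^ N) by (apply Rmult_lt_0_compat; trivial; apply pow_lt; lra).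
  apply Rmult_le_reg_r with (al + de * 2 ^ N); [lra |].
  unfold Rdiv. rewrite Rmult_assoc, Rinv_l by lra. nra.
Qed.

(** The levels not exceeding [v], together with the initial [de], add up to the next dyadic level.
    The term [de] alone covers values below the lowest scale. *)
Lemma dyadic_layer_cake de v N : 0 < de -> v <= de * 2 ^ N ->
  v <= de + fsum N (fun m => de * 2 ^ m * indic (de * 2 ^ m) v).
Proof.
  intros hde hv.
  assert (h : Rmin v (de * 2 ^ N) <= de + fsum N (fun m => de * 2 ^ m * indic (de * 2 ^ m) v)).
  { clear hv. induction N as [|N IH]; simpl fsum.
    - rewrite Rplus_0_r. eapply Rle_trans; [apply Rmin_r | simpl; lra].
    - replace (de * 2 ^ S N) with (2 * (de * 2 ^ N)) by (simpl; ring).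
      assert (hu : 0 < de * 2 ^ N) by (apply Rmult_lt_0_compat; trivial; apply pow_lt; lra).
      set (u := de * 2 ^ N) in *. unfold indic at 2. unfold Rmin in *.
      destruct (Rle_dec u v), (Rle_dec v u), (Rle_dec v (2 * u)); lra. }
  rewrite Rmin_left in h; assumption.
Qed.

Lemma dyadic_unbounded de B : 0 < de -> exists N, B <= de * 2 ^ N.
Proof.
  intros hde. destruct (INR_unbounded (B / de)) as [N hN]. exists N.
  assert (h2 : INR N <= 2 ^ N).
  { clear. induction N as [|N IH]; [simpl; lra |].
    rewrite S_INR. simpl. assert (1 <= 2 ^ N) by (apply pow_R1_Rle; lra). lra. }
  apply Rmult_le_reg_r with (/ de); [now apply Rinv_0_lt_compat |].
  replace (de * 2 ^ N * / de) with (2 ^ N) by (field; lra). unfold Rdiv in hN. lra.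
Qed.

(** * Threshold embeddings: all scales together *)

Section Threshold.
Context (p : R) (Z : Banach) (X : Type) (d : X -> X -> R) (D S : R).
Context (hp : 1 < p <= 2) (hmet : is_metric d) (hS : smooth_with Z p S).
Context (hphi : threshold_embeds X d Z D).
Context (n : nat) (pi : nat -> R) (P : nat -> nat -> R) (f : nat -> X).
Context (hchain : reversible_chain n pi P).

Let v (i j : nat) : R := rpow (d (f i) (f j)) p.
Let q (i j : nat) : R := rpow (2 * D) p * v i j.
Let b (i : nat) : R := fsum n (fun j => P i j * q i j).
Let kappa : R := 224 * rpow S p + 32.

Let q_nonneg i j : 0 <= q i j.
Proof. apply Rmult_le_pos; apply rpow_nonneg. Qed.

Let b_nonneg i : (i < n)%nat -> 0 <= b i.
Proof.
  destruct hchain as [_ [_ [hP _]]].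
  intros; apply fsum_nonneg; intros; apply Rmult_le_pos; auto.
Qed.

Lemma distance_tail u t : 0 < u ->
  path_expect n P pi t (fun l => indic u (v (hd 0%nat l) (last l 0%nat)))
  <= 56 * path_expect n P pi t (fun l => trunc_sqr (kappa * visit_sum b l / u))
     + 8 * (INR t * fsum n (fun i => pi i *
              fsum n (fun j => P i j * trunc_sqr (2 * (q i j + b i) / u))))
     + 2 * fsum n (fun i => pi i * trunc_sqr (b i / u)).
Proof.
  intros hu. destruct hphi as [hD hemb]. destruct hmet as [hd0 [_ [hdsym _]]].
  destruct hchain as [hpi0 [hpi1 [hP0 [hP1 [hstat hrev]]]]].
  set (tau := rpow u (/ p)).
  assert (htau : 0 < tau) by now apply rpow_pos.
  assert (htp : rpow tau p = u).
  { unfold tau. rewrite rpow_rpow, Rinv_l by lra. apply rpow_1_r; lra. }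
  destruct (hemb tau htau) as [phi [L [hL [hlip hthr]]]].
  set (c := 2 * D / (L * tau)).
  assert (hLt : 0 < L * tau) by now apply Rmult_lt_0_compat.
  assert (hc : 0 < c) by (apply Rdiv_lt_0_compat; lra).
  set (F := fun i => bscal Z c (phi (f i))).
  assert (hF : forall i j, bnorm Z (bsub Z (F j) (F i))
    = c * bnorm Z (bsub Z (phi (f j)) (phi (f i)))).
  { intros i j. unfold F, bsub. rewrite <- bscal_opp, <- bscal_distr_v, bnorm_scal, Rabs_pos_eq;
    [trivial | lra]. }
  assert (hr : forall i j, rpow (bnorm Z (bsub Z (F j) (F i))) p <= / u * q i j).
  { intros i j.
    apply Rle_trans with (rpow (2 * D * d (f i) (f j) * / tau) p).
    - apply rpow_le; [lra |]. rewrite hF.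
      replace (2 * D * d (f i) (f j) * / tau) with (c * (L * d (f j) (f i)))
        by (unfold c; rewrite (hdsym (f j)); field; lra).
      apply Rmult_le_compat_l; [lra | apply hlip].
    - right. rewrite rpow_mult, rpow_mult, rpow_inv, htp; trivial; [| lra | |].
      + unfold q, v. ring.
      + apply Rmult_le_pos; [lra | trivial].
      + left; now apply Rinv_0_lt_compat. }
  assert (hb : forall i, fsum n (fun j => P i j * (/ u * q i j)) = / u * b i).
  { intros i. unfold b. rewrite <- fsum_scal. apply fsum_ext; intros; ring. }
  assert (H := displacement_tail n P hP0 hP1 pi hpi0 hstat hrev p S hp hS F
    (fun i j => / u * q i j) hr t).
  eapply Rle_trans; [| eapply Rle_trans; [exact H |]].
  - apply path_expect_le; trivial. intros l _ _. unfold indic at 1.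
    destruct (Rle_dec u _) as [h|_]; [| apply indic_nonneg].
    unfold indic. destruct (Rle_dec 2 _) as [_|hn]; [lra | exfalso; apply hn].
    rewrite hF. rewrite <- htp in h. unfold v in h. apply rpow_le_inv in h; [| lra | trivial].
    rewrite hdsym in h. apply hthr in h.
    apply Rle_trans with (c * (L * tau / D)); [right; unfold c; field; lra |].
    apply Rmult_le_compat_l; lra.
  - apply Rplus_le_compat; [apply Rplus_le_compat |].
    + apply Rmult_le_compat_l; [lra |]. apply path_expect_le; trivial. intros l _ _. right.
      f_equal. rewrite (visit_sum_ext _ (fun i => / u * b i) l hb), visit_sum_scal.
      unfold kappa, Rdiv. ring.
    + apply Rmult_le_compat_l; [lra |]. apply Rmult_le_compat_l; [apply pos_INR |].
      right. apply fsum_ext; intros i hi. f_equal. apply fsum_ext; intros j hj.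
      do 2 f_equal. rewrite hb. unfold Rdiv; ring.
    + apply Rmult_le_compat_l; [lra |]. right. apply fsum_ext; intros i hi.
      do 2 f_equal. rewrite hb. unfold Rdiv; ring.
Qed.

Lemma markov_moment_path t :
  markov_moment d p n pi P f t
    = path_expect n P pi t (fun l => v (hd 0%nat l) (last l 0%nat)).
Proof. symmetry. apply (path_expect_ends n P pi t v). Qed.

Lemma markov_moment_1 :
  markov_moment d p n pi P f 1 = fsum n (fun i => pi i * fsum n (fun j => P i j * v i j)).
Proof.
  apply fsum_ext; intros i hi. rewrite <- fsum_scal. apply fsum_ext; intros j hj.
  simpl. rewrite (fsum_delta n i (fun k => P k j) hi). unfold v. ring.
Qed.

Lemma stationary_b : fsum n (fun i => pi i * b i)
  = rpow (2 * D) p * markov_moment d p n pi P f 1.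
Proof.
  rewrite markov_moment_1, <- fsum_scal. apply fsum_ext; intros i hi.
  unfold b, q. rewrite <- !fsum_scal. apply fsum_ext; intros; ring.
Qed.

(** With 6 the constant of the dyadic sum: [336 = 56 * 6], [12 = 2 * 6], and [192 = 8 * 24], where
    [24 = 12 + 12] because [q] and [b] have the same stationary mean. The summand without [INR t]
    comes from the drifts at the two endpoints. *)
Lemma markov_moment_le_eps t de : 0 < de ->
  markov_moment d p n pi P f t
  <= de + (INR t * (336 * kappa + 192) + 12)
          * (rpow (2 * D) p * markov_moment d p n pi P f 1).
Proof.
  intros hde. destruct hchain as [hpi0 [hpi1 [hP0 [hP1 [hstat hrev]]]]].
  assert (hk : 0 <= kappa) by (unfold kappa; pose proof (rpow_nonneg S p); lra).
  assert (hv0 : forall i j, 0 <= v i j) by (intros; apply rpow_nonneg).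
  (* There are finitely many states, so the sum of all [v i j] bounds each of them and finitely many
     scales suffice. *)
  destruct (dyadic_unbounded de (fsum n (fun i => fsum n (fun j => v i j))) hde) as [N hN].
  assert (hvN : forall i j, (i < n)%nat -> (j < n)%nat -> v i j <= de * 2 ^ N).
  { intros i j hi hj. eapply Rle_trans; [| exact hN].
    eapply Rle_trans; [apply (fsum_term_le n (fun j => v i j)); auto |].
    apply (fsum_term_le n (fun i => fsum n (fun j => v i j))); trivial.
    intros; apply fsum_nonneg; auto. }
  set (u := fun m => de * 2 ^ m).
  assert (hu : forall m, 0 < u m) by (intros; apply Rmult_lt_0_compat; trivial; apply pow_lt; lra).
  rewrite markov_moment_path, <- stationary_b.
  apply Rle_trans with (path_expect n P pi t (fun l => de
    + fsum N (fun m => u m * indic (u m) (v (hd 0%nat l) (last l 0%nat))))).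
  { apply path_expect_le; trivial. intros l hl hF. apply dyadic_layer_cake; trivial.
    apply hvN; [destruct hF; [congruence | assumption] | now apply last_lt]. }
  rewrite path_expect_plus, path_expect_const, path_expect_fsum by assumption.
  apply Rplus_le_compat_l.
  apply Rle_trans with (fsum N (fun m =>
     56 * path_expect n P pi t (fun l => u m * trunc_sqr (kappa * visit_sum b l / u m))
     + 8 * INR t * (fsum n (fun i => fsum n (fun j =>
         pi i * P i j * (u m * trunc_sqr (2 * (q i j + b i) / u m)))))
     + 2 * fsum n (fun i => pi i * (u m * trunc_sqr (b i / u m))))).
  { apply fsum_le; intros m _. rewrite !path_expect_scal.
    apply Rle_trans with (u m * (56 * path_expect n P pi t (fun l => trunc_sqr (kappa * visit_sum b l / u m))
     + 8 * (INR t * fsum n (fun i => pi i *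
              fsum n (fun j => P i j * trunc_sqr (2 * (q i j + b i) / u m))))
     + 2 * fsum n (fun i => pi i * trunc_sqr (b i / u m)))).
    - apply Rmult_le_compat_l; [specialize (hu m); lra | now apply distance_tail].
    - right.
      rewrite (fsum_ext n (fun i => fsum n _) (fun i => u m * (pi i *
        fsum n (fun j => P i j * trunc_sqr (2 * (q i j + b i) / u m))))).
      2: { intros i hi. rewrite <- !fsum_scal. apply fsum_ext; intros; ring. }
      rewrite (fsum_ext n (fun i => pi i * (u m * _)) (fun i => u m * (pi i * trunc_sqr (b i / u m))))
        by (intros; ring).
      rewrite !fsum_scal. ring. }
  rewrite !fsum_plus, !fsum_scal.
  set (B := fsum n (fun i => pi i * b i)).
  assert (h1 : fsum N (fun m => path_expect n P pi t
      (fun l => u m * trunc_sqr (kappa * visit_sum b l / u m))) <= 6 * kappa * (INR t * B)).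
  { rewrite <- path_expect_fsum by assumption.
    unfold B. rewrite <- (path_expect_visit_sum n P hP1 pi hstat), <- path_expect_scal.
    apply path_expect_le; trivial. intros l hl hF.
    rewrite Rmult_assoc. apply dyadic_trunc_sqr_sum; trivial.
    apply Rmult_le_pos; trivial. apply visit_sum_nonneg with n; auto. }
  assert (h2 : fsum N (fun m => fsum n (fun i => fsum n (fun j =>
      pi i * P i j * (u m * trunc_sqr (2 * (q i j + b i) / u m))))) <= 24 * B).
  { rewrite fsum_swap.
    apply Rle_trans with (fsum n (fun i => 24 * (pi i * b i))); [| rewrite fsum_scal; unfold B; lra].
    apply fsum_le; intros i hi. rewrite fsum_swap.
    apply Rle_trans with (fsum n (fun j => (12 * pi i) * (P i j * q i j) + (12 * pi i * b i) * P i j)).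
    - apply fsum_le; intros j hj. rewrite fsum_scal.
      replace ((12 * pi i) * (P i j * q i j) + (12 * pi i * b i) * P i j)
        with (pi i * P i j * (6 * (2 * (q i j + b i)))) by ring.
      apply Rmult_le_compat_l; [apply Rmult_le_pos; auto |].
      apply dyadic_trunc_sqr_sum; trivial.
      specialize (b_nonneg i hi). specialize (q_nonneg i j). lra.
    - rewrite fsum_plus, !fsum_scal, hP1 by assumption. fold (b i). lra. }
  assert (h3 : fsum N (fun m => fsum n (fun i => pi i * (u m * trunc_sqr (b i / u m)))) <= 6 * B).
  { rewrite fsum_swap. unfold B. rewrite <- fsum_scal. apply fsum_le; intros i hi.
    rewrite fsum_scal. replace (6 * (pi i * b i)) with (pi i * (6 * b i)) by ring.
    apply Rmult_le_compat_l; auto. apply dyadic_trunc_sqr_sum; auto. }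
  assert (ht := pos_INR t).
  apply Rmult_le_compat_l with (r := 8 * INR t) in h2; [| lra].
  lra.
Qed.

Lemma markov_moment_0 : markov_moment d p n pi P f 0 = 0.
Proof.
  destruct hmet as [_ [hd0 _]].
  rewrite <- (fsum_0 n). apply fsum_ext; intros i hi. rewrite <- (fsum_0 n). apply fsum_ext; intros j hj.
  simpl. destruct (Nat.eqb_spec i j) as [-> |]; [| ring].
  rewrite (proj2 (hd0 _ _) eq_refl), rpow_0_l. ring.
Qed.

Lemma markov_moment_1_nonneg : 0 <= markov_moment d p n pi P f 1.
Proof.
  destruct hchain as [hpi0 [_ [hP0 _]]].
  rewrite markov_moment_1. apply fsum_nonneg; intros i hi. apply Rmult_le_pos; auto.
  apply fsum_nonneg; intros j hj. apply Rmult_le_pos; auto. apply rpow_nonneg.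
Qed.

(** Two points at positive distance would violate the threshold condition at [tau] equal to that
    distance. The case stands apart because smoothness is then vacuous and gives no lower bound on
    [S]. *)
Lemma markov_moment_trivial t :
  (forall z : Z, bnorm Z z = 0) -> markov_moment d p n pi P f t = 0.
Proof.
  intros hz. destruct hphi as [hD hemb]. destruct hmet as [hd0 _].
  rewrite <- (fsum_0 n). apply fsum_ext; intros i hi. rewrite <- (fsum_0 n). apply fsum_ext; intros j hj.
  replace (d (f i) (f j)) with 0; [rewrite rpow_0_l; ring |].
  destruct (hd0 (f i) (f j)) as [h|h]; [exfalso | assumption].
  destruct (hemb _ h) as [phi [L [hL [_ hthr]]]].
  specialize (hthr (f i) (f j) ltac:(lra)). rewrite hz in hthr.
  assert (0 < L * d (f i) (f j) / D) by (apply Rdiv_lt_0_compat; trivial; now apply Rmult_lt_0_compat).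
  lra.
Qed.

End Threshold.

Theorem theorem3p1 :
  exists C : R, 0 < C /\
  forall (p : R) (Z : Banach) (X : Type) (d : X -> X -> R) (D S : R),
    1 < p -> p <= 2 ->
    is_metric d ->
    0 < S -> smooth_with Z p S ->
    threshold_embeds X d Z D ->
    markov_type_const X d p (C * D * S).
Proof.
  exists 300000. split; [lra |].
  intros p Z X d D S hp1 hp2 hmet hS0 hS hphi n pi P f t hchain.
  assert (hM := markov_moment_1_nonneg p X d n pi P f hchain).
  assert (hp : 1 < p <= 2) by lra.
  assert (hD : 0 < D) by apply hphi.
  assert (hRHS : 0 <= rpow (300000 * D * S) p * INR t * markov_moment d p n pi P f 1).
  { apply Rmult_le_pos; trivial. apply Rmult_le_pos; [apply rpow_nonneg | apply pos_INR]. }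
  (* The endpoint term 12 carries no factor [INR t] and can be absorbed only when [1 <= INR t]. *)
  destruct t as [|t]; [rewrite (markov_moment_0 p X d hmet); exact hRHS |].
  destruct (classic (forall z : Z, bnorm Z z = 0)) as [h0 | h0].
  { rewrite (markov_moment_trivial p Z X d D hmet hphi); assumption. }
  apply not_all_ex_not in h0. destruct h0 as [z hz].
  assert (hz0 : 0 < bnorm Z z) by (pose proof (bnorm_nonneg z); lra).
  assert (hs : / 4 <= rpow S p).
  { apply (smooth_const_ge p S hp hS (bscal Z (/ bnorm Z z) z)).
    rewrite bnorm_scal, Rabs_pos_eq; [field; lra | left; now apply Rinv_0_lt_compat]. }
  apply Rle_plus_epsilon. intros de hde. rewrite Rplus_comm.
  eapply Rle_trans; [now apply (markov_moment_le_eps p Z X d D S hp hmet hS hphi n pi P f hchain _ de) |].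
  apply Rplus_le_compat_l. rewrite <- Rmult_assoc. apply Rmult_le_compat_r; trivial.
  (* A factor 2 goes with [D]; the rest may enter the [p]-th power because [150000 <= 150000^p]. *)
  replace (300000 * D * S) with (150000 * (2 * D) * S) by ring.
  rewrite !(rpow_mult (150000 * (2 * D))), (rpow_mult 150000) by nra.
  assert (h2D := rpow_nonneg (2 * D) p).
  assert (hC : 150000 <= rpow 150000 p).
  { rewrite <- (rpow_1_r 150000) at 1 by lra. apply rpow_exp_le; lra. }
  assert (hT : 1 <= INR (Datatypes.S t)) by (rewrite S_INR; pose proof (pos_INR t); lra).
  set (T := INR (Datatypes.S t)) in *. set (s := rpow S p) in *. set (c := rpow 150000 p) in *.
  set (e := rpow (2 * D) p) in *.
  replace (c * e * s * T) with (c * s * T * e) by ring.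
  apply Rmult_le_compat_r; trivial.
  apply Rle_trans with (150000 * s * T).
  (* Here [204 = 192 + 12], by [1 <= T]. With [/ 4 <= s] the left side is at most
     [(75264 + 4 * 10956) * s = 119088 * s]. *)
  - assert (h : 336 * (224 * s + 32) + 204 <= 150000 * s) by lra. nra.
  - apply Rmult_le_compat_r; [lra |]. apply Rmult_le_compat_r; lra.
Qed.
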